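(* Let $\varphi(x)=e^{-|x|}$. Assume that $v_0 \in H^1(\mathbb{R}) \cap C^1_0$ with $v_0(0)=0$. There exists a unique global solution $v \in C(\mathbb{R},H^1(\mathbb{R}) \cap C^1_0)$ to the Cauchy problem $$\frac{dv}{dt} = Av, \quad t\in\mathbb{R}, \qquad v|_{t=0}=v_0,$$ with $$(A v)(x) = \left[ 1 - \varphi(x) \right] v'(x) + \varphi(x) \int_0^x v(y)\, dy, \quad x \in \mathbb{R},$$ satisfying $v(t,0)=0$ for every $t \in \mathbb{R}$.
   Context: The space $C^1_0$ is $$C^1_0 := \{ v \in C^0(\mathbb{R}) \cap C^1(\mathbb{R}^-) \cap C^1(\mathbb{R}^+): \ v, \partial_x v \in L^{\infty}(\mathbb{R}) \},$$ i.e. bounded continuous functions on $\mathbb{R}$ that are piecewise continuously differentiable, with a finite jump discontinuity of the first derivative at $x=0$ and bounded first derivative away from $x=0$. For $v\in H^1\cap C^1_0$ with $v(0)=0$, the term $[1-\varphi(x)]v'(x)$ is extended by continuity with value $0$ at $x=0$ (since $\varphi(0)=1$).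
   Formalization: Continuity in time into C^1_0 means uniform convergence of v on R, uniform convergence of v_x on bounded sets, and locally bounded sup|v_x|; continuity for the norm sup|v|+sup|v_x| fails when v_0' has ever narrower bumps at infinity. *)

(* Defs.v *)
From HB Require Import structures.
From mathcomp Require Import all_boot all_order all_algebra.
From mathcomp Require Import all_classical all_reals all_analysis.
Import Order.TTheory GRing.Theory Num.Theory.
Import numFieldNormedType.Exports.

Set Implicit Arguments.
Unset Strict Implicit.
Unset Printing Implicit Defensive.

Local Open Scope ring_scope.
Local Open Scope classical_set_scope.

Section Spaces.
Context {R : realType}.
Notation mu := (@lebesgue_measure R).
Implicit Types v g psi : R -> R.

Definition L2norm v : \bar R := 'N[mu]_(2%:E)[EFin \o v]%E.

Definition L2 v : Prop := v \in Lfun mu 2%:E.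

Definition test_C1c psi : Prop :=
  [/\ forall x : R, derivable psi x 1,
      continuous (derive1 psi)
    & compact (closure [set x | psi x != 0])].

(* In dimension one, C^1 compactly supported test functions define the same
   weak derivative as C^oo ones. *)
Definition weak_derivative v g : Prop :=
  forall psi, test_C1c psi ->
    \int[mu]_x (v x * derive1 psi x) = - \int[mu]_x (g x * psi x).

Definition H1 v : Prop :=
  L2 v /\ exists2 g, L2 g & weak_derivative v g.

(* Some representative of the weak derivative in L^2, for v in H^1; the
   representative is unique only up to a null set. *)
Definition wderiv v : R -> R :=
  xget (fun=> 0) [set g | L2 g /\ weak_derivative v g].

Definition H1norm v : \bar R :=
  ((L2norm v ^+ 2 + L2norm (wderiv v) ^+ 2) `^ 2^-1)%E.

(* The derivative extends continuously to each of the closed half-lines, with a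
   possible finite jump at 0. The value of derive1 v at 0 is irrelevant. *)
Definition C10 v : Prop :=
  [/\ continuous v,
      forall x : R, x != 0 ->
        derivable v x 1 /\ {for x, continuous (derive1 v)},
      cvg (derive1 v x @[x --> 0^'-]) /\ cvg (derive1 v x @[x --> 0^'+])
    & [bounded v x | x in setT] /\
      [bounded derive1 v x | x in [set x | x != 0]]].

End Spaces.

Section Evolution.
Context {R : realType}.
Notation mu := (@lebesgue_measure R).
Implicit Types (v : R -> R) (u : R -> R -> R).

Definition peakon (x : R) : R := expR (- `|x|).

(* The integral from 0 to x, oriented: for x <= 0 it is minus the integral over
   [x, 0]. *)
Definition primitive v (x : R) : R :=
  \int[mu]_(y in `[0, x]) v y - \int[mu]_(y in `[x, 0]) v y.

(* Since peakon 0 = 1, the first summand is 0 at x = 0 whatever the value of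
   derive1 v there: this is its extension by continuity for v in C10. *)
Definition opA v (x : R) : R :=
  (1 - peakon x) * derive1 v x + peakon x * primitive v x.

Definition continuous_into_H1 u : Prop :=
  (forall t, H1 (u t)) /\
  forall t0, H1norm (u t \- u t0) @[t --> t0] --> 0%E.

(* C10 carries uniform convergence of the functions and, for the derivatives,
   uniform convergence on bounded sets with uniform bounds on the whole line.
   Uniform convergence of the derivatives on the whole line is not available:
   far from 0 the equation is close to u_t = u_x, and translations act
   continuously for that topology only on functions whose derivative is
   uniformly continuous at infinity. *)
Definition continuous_into_C10 u : Prop :=
  (forall t, C10 (u t)) /\
  forall t0,
    [/\ forall e, 0 < e ->
          \forall t \near t0, forall x, `|u t x - u t0 x| < e,
        forall K e, 0 < e ->
          \forall t \near t0, forall x, x != 0 -> `|x| <= K ->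
            `|derive1 (u t) x - derive1 (u t0) x| < e
      & exists M, \forall t \near t0, forall x, x != 0 -> `|derive1 (u t) x| <= M].

(* du/dt = A u, both as a strong derivative in L^2 and at every point x. *)
Definition solves_evolution u : Prop :=
  forall t,
    L2norm (fun x => h^-1 * (u (t + h) x - u t x) - opA (u t) x)
      @[h --> 0^'] --> 0%E
    /\ forall x, is_derive t 1 (fun s => u s x) (opA (u t) x).

Definition solution (v0 : R -> R) u : Prop :=
  [/\ continuous_into_H1 u, continuous_into_C10 u, solves_evolution u
    & u 0 = v0].

End Evolution.

(* Main.v *)
Require Import Defs.
From HB Require Import structures.
From mathcomp Require Import all_boot all_order all_algebra.
From mathcomp Require Import all_classical all_reals all_analysis.
From mathcomp Require Import measurable_realfun ring lra.
Import Order.TTheory GRing.Theory Num.Theory.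
Import numFieldNormedType.Exports.

Local Open Scope ring_scope.
Local Open Scope classical_set_scope.

(** The operator splits into a transport part (1 - phi) v' and a nonlocal part
    phi * primitive v. The speed 1 - phi vanishes at the corner 0, so that the
    characteristics, the trajectories of flow, fix 0 and never cross it; they are
    explicit because the speed becomes linear in the variable expR |x|. Along
    them the solution is explicit too:

      v (t, x) = v0 (flow t x) + gain t x * primitive v0 (flow t x),

    the right-hand side being evol t v0. What makes it work is primitive_evol:
    the primitive of evol t v0 is the primitive of v0 carried along the flow and
    divided by the derivative slope of the flow. In terms of the primitive the
    nonlocal equation is thus a transport equation with a multiplicative weight,
    and the cocycle identity slopeD of this weight gives the group property
    evolD. Every assertion on the dependence in time reduces by evolD to time 0,
    for the datum evol t v0, which lies in the same space (C10_evol, H1_evol).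

    The H1 norm of a function in C10 is computed from its classical derivative.
    This rests on an integration by parts in which the boundary terms at the
    corner cancel (C10_weak_derivative) and on the fundamental lemma of the
    calculus of variations (weak_derivative_ae).

    Limits in the mean square are obtained by one device, sqint_cvg: pointwise
    convergence together with an upper bound of the norms tending to the norm of
    the limit gives convergence. For transported functions the norm is bounded by
    sqint_flow, as the flow changes Lebesgue measure by a factor at most
    expR |t|. For the difference quotients it is bounded by
    sqint_flow_increment, from Cauchy-Schwarz in time and Tonelli. The nonlocal
    terms need no such argument: the primitive of a bounded function grows at
    most linearly, and the exponential decay of the gain turns this into a bound
    by a multiple of a fixed square-integrable function that tends to 0 with t.

    Convergence in C10 follows from uniform continuity of the derivative on
    compact pieces of the two closed half-lines.

    For uniqueness, the difference D of two solutions is followed along a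
    characteristic (is_derive_characteristic): the transport terms cancel, and
    the time derivative that remains, phi * primitive D, is at most twice the sup
    norm of D. So, starting from D = 0, any bound valid up to a time distance at
    most 1/4 is improved there by the factor 1/2; hence D vanishes for short
    times, and for all times because the line is connected. *)

Set Implicit Arguments.
Unset Strict Implicit.
Unset Printing Implicit Defensive.

(** * Square-integrable functions *)

Section SquareIntegral.
Context {R : realType}.
Notation mu := (@lebesgue_measure R).
Implicit Types f g : R -> R.

(** The square of the norm: identities such as the parallelogram law are stated
    without a root. *)
Definition sqint f : \bar R := (\int[mu]_x ((f x) ^+ 2)%:E)%E.

Lemma sqint_ge0 f : (0 <= sqint f)%E.
Proof. by apply: integral_ge0 => x _; rewrite lee_fin sqr_ge0. Qed.

Lemma L2norm_sqint f : L2norm f = (sqint f `^ 2^-1)%E.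
Proof.
rewrite /L2norm /sqint unlock /=; congr (_ `^ _)%E.
by apply: eq_integral => x _; rewrite /= powR_mulrn// real_normK ?num_real.
Qed.

Lemma L2norm_sqr f : (L2norm f ^+ 2)%E = sqint f.
Proof.
by rewrite L2norm_sqint poweR12_sqrt ?sqint_ge0// sqr_sqrte// sqint_ge0.
Qed.

Lemma measurable_sqr f : measurable_fun setT f ->
  measurable_fun setT (EFin \o (fun x => f x ^+ 2)).
Proof. by move=> mf; apply/measurable_EFinP; exact: measurable_funX. Qed.

Lemma L2P f : L2 f <-> measurable_fun setT f /\ (sqint f < +oo)%E.
Proof.
rewrite /L2 inE; split.
  move=> /andP[mf]; rewrite inE/= /finite_norm => l2f.
  move: mf; rewrite inE/= => mf; split=> //.
  move: l2f; rewrite -/(L2norm f) L2norm_sqint; exact: lty_poweRy.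
move=> [mf sf]; apply/andP; rewrite !inE/=; split=> //.
by rewrite /finite_norm -/(L2norm f) L2norm_sqint poweR_lty.
Qed.

Lemma le_sqint f g : measurable_fun setT f -> measurable_fun setT g ->
  (forall x, `|f x| <= `|g x|) -> (sqint f <= sqint g)%E.
Proof.
move=> mf mg fg; apply: ge0_le_integral => //.
- by move=> x _; rewrite lee_fin sqr_ge0.
- exact: measurable_sqr.
- exact: measurable_sqr.
- move=> x _; rewrite lee_fin -(real_normK (num_real (f x))).
  by rewrite -(real_normK (num_real (g x))) lerXn2r ?nnegrE.
Qed.

Lemma sqintZ (c : R) f : measurable_fun setT f ->
  sqint (fun x => c * f x) = ((c ^+ 2)%:E * sqint f)%E.
Proof.
move=> mf; rewrite /sqint; under eq_integral do rewrite exprMn EFinM.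
rewrite ge0_integralZl//; first exact: measurable_sqr.
- by move=> x _; rewrite lee_fin sqr_ge0.
- by rewrite lee_fin sqr_ge0.
Qed.

Lemma ae_mono (P Q : R -> Prop) : (forall x, P x -> Q x) ->
  {ae mu, forall x, P x} -> {ae mu, forall x, Q x}.
Proof.
by move=> PQ; apply: filterS => //; exact: (ae_filter_ringOfSetsType mu).
Qed.

Lemma ae_eq_sqint f g : measurable_fun setT f -> measurable_fun setT g ->
  {ae mu, forall x, f x = g x} -> sqint f = sqint g.
Proof.
move=> mf mg fg; apply: ae_eq_integral => //; try exact: measurable_sqr.
by apply: ae_mono fg => x /= -> _.
Qed.

Lemma ae_neq0 : {ae mu, forall x : R, x != 0}.
Proof.
exists [set 0]; split; [exact: measurable_set1|exact: lebesgue_measure_set1|].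
by move=> x /= /negP; rewrite negbK => /eqP.
Qed.

Lemma eq_sqint_neq0 f g : measurable_fun setT f -> measurable_fun setT g ->
  (forall x, x != 0 -> f x = g x) -> sqint f = sqint g.
Proof.
by move=> mf mg fg; apply: ae_eq_sqint => //; exact: ae_mono ae_neq0.
Qed.

Lemma sqint_parallelogram f g : measurable_fun setT f -> measurable_fun setT g ->
  (sqint (f \+ g)%R + sqint (f \- g)%R = 2%:E * sqint f + 2%:E * sqint g)%E.
Proof.
move=> mf mg; rewrite /sqint.
have m2 (h : R -> R) : measurable_fun setT h ->
    measurable_fun setT (fun x : R => (2%:E * ((h x) ^+ 2)%:E)%E : \bar R).
  by move=> mh; apply: measurable_funeM; exact: measurable_sqr.
have p2 (h : R -> R) x : (0 <= ((h x) ^+ 2)%:E)%E by rewrite lee_fin sqr_ge0.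
rewrite -!ge0_integralZl ?lee_fin//; try exact: measurable_sqr.
rewrite -!ge0_integralD//.
- apply: eq_integral => x _; rewrite -!EFinM -!EFinD; congr EFin => /=; ring.
- by move=> x _; rewrite mule_ge0// lee_fin.
- exact: m2.
- by move=> x _; rewrite mule_ge0// lee_fin.
- exact: m2.
- by apply: measurable_sqr; exact: measurable_funD.
- by apply: measurable_sqr; exact: measurable_funB.
Qed.

Lemma sqintD f g : measurable_fun setT f -> measurable_fun setT g ->
  (sqint (f \+ g)%R <= 2%:E * sqint f + 2%:E * sqint g)%E.
Proof.
by move=> mf mg; rewrite -sqint_parallelogram// leeDl// sqint_ge0.
Qed.

Lemma L2D f g : L2 f -> L2 g -> L2 (f \+ g).
Proof.
move=> /L2P[mf lf] /L2P[mg lg]; apply/L2P; split; first exact: measurable_funD.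
apply: le_lt_trans (sqintD mf mg) _.
have fin h : (sqint h < +oo)%E -> (2%:E * sqint h < +oo)%E.
  by move=> lh; rewrite lte_mul_pinfty ?lee_fin.
by rewrite lte_add_pinfty ?fin.
Qed.

Lemma L2Z (c : R) f : L2 f -> L2 (fun x => c * f x).
Proof.
move=> /L2P[mf lf]; apply/L2P; split; first exact: measurable_funM.
by rewrite sqintZ// lte_mul_pinfty// lee_fin sqr_ge0.
Qed.

Lemma L2B f g : L2 f -> L2 g -> L2 (f \- g).
Proof.
move=> lf /(L2Z (-1)) lg; have -> : f \- g = f \+ (fun x => -1 * g x).
  by apply/funext => x /=; rewrite mulN1r.
exact: L2D.
Qed.

Lemma le_L2 f g : measurable_fun setT f -> L2 g ->
  (forall x, `|f x| <= `|g x|) -> L2 f.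
Proof.
move=> mf /L2P[mg lg] fg; apply/L2P; split=> //.
exact: le_lt_trans (le_sqint mf mg fg) lg.
Qed.

Lemma eq_L2 f g : measurable_fun setT f ->
  (forall x, x != 0 -> f x = g x) -> L2 g -> L2 f.
Proof.
move=> mf fg /L2P[mg lg]; apply/L2P; split=> //.
by rewrite (eq_sqint_neq0 mf mg fg).
Qed.

(** Fatou's lemma for (F n + f)^2 and the parallelogram identity: no mass of
    F n can be lost in the limit, so pointwise convergence is convergence in
    the mean. *)
Lemma sqint_cvg_seq (F : nat -> R -> R) f (c : nat -> R) :
  (forall n, measurable_fun setT (F n)) -> L2 f ->
  (forall x, x != 0 -> F n x @[n --> \oo] --> f x) ->
  (forall n, (sqint (F n) <= (c n)%:E * sqint f)%E) ->
  c n @[n --> \oo] --> (1 : R) ->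
  sqint (F n \- f)%R @[n --> \oo] --> 0%E.
Proof.
move=> mF /L2P[mf lf] Ff Fc c1.
have fin : sqint f \is a fin_num by rewrite ge0_fin_numE// sqint_ge0.
pose I := fine (sqint f).
have IE : sqint f = I%:E by rewrite fineK.
have par n : (sqint (F n \+ f)%R + sqint (F n \- f)%R <= (2 * (c n * I) + 2 * I)%:E)%E.
  rewrite sqint_parallelogram// IE [leRHS]EFinD; apply: leeD => //.
  rewrite [leRHS]EFinM; apply: lee_pmul => //; first exact: sqint_ge0.
  by rewrite EFinM -IE.
have fat : ((4 * I)%:E <= limn_einf (fun n => sqint (F n \+ f)%R))%E.
  have -> : ((4 * I)%:E = \int[mu]_x (limn_einf (fun n => ((F n \+ f)%R x ^+ 2)%:E)))%E.
    rewrite EFinM -IE /sqint -ge0_integralZl//; last 2 first.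
    - exact: measurable_sqr.
    - by move=> x _; rewrite lee_fin sqr_ge0.
    apply: ae_eq_integral => //.
    - by apply: measurable_funeM; exact: measurable_sqr.
    - rewrite /limn_einf; apply: measurableT_comp => //.
      apply: measurable_fun_limn_esup => n; apply: measurableT_comp => //.
      by apply: measurable_sqr; exact: measurable_funD.
    apply: ae_mono ae_neq0 => x x0 _; apply/esym.
    apply: (cvg_limn_einf_sup _).1.
    rewrite -EFinM; apply: cvg_EFin; first by near=> n.
    rewrite (_ : 4 * f x ^+ 2 = (f x + f x) ^+ 2); last by ring.
    have h : (F n x + f x) @[n --> \oo] --> f x + f x.
      by apply: cvgD; [exact: Ff|exact: cvg_cst].
    by rewrite expr2; exact: cvgM.
  apply: fatou => //.
  - by move=> n; apply: measurable_sqr; exact: measurable_funD.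
  - by move=> n x _; rewrite lee_fin sqr_ge0.
(* By the parallelogram identity d n <= 2 (c n + 1) I - a n, whose upper limit is
   at most 4 I - 4 I = 0. *)
pose a n := sqint (F n \+ f)%R; pose d n := sqint (F n \- f)%R.
have an n : a n \is a fin_num.
  rewrite ge0_fin_numE ?sqint_ge0//; apply: le_lt_trans (ltry _).
  by apply: le_trans (par n); rewrite leeDl// sqint_ge0.
have dn n : d n \is a fin_num.
  rewrite ge0_fin_numE ?sqint_ge0//; apply: le_lt_trans (ltry _).
  by apply: le_trans (par n); rewrite leeDr// sqint_ge0.
have dE n : sqint (F n \- f)%R = (fine (d n))%:E by rewrite fineK.
under eq_fun do rewrite dE; apply: cvg_EFin; first by near=> n.
apply/cvgr0Pnorm_le => e e0.
have lim1 : 2 * (c n * I) + 2 * I @[n --> \oo] --> 2 * (1 * I) + 2 * I.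
  by apply: cvgD; [apply: cvgMr; exact: cvgMl|exact: cvg_cst].
have e2 : 0 < e / 2 by rewrite divr_gt0.
have {lim1} : \forall n \near \oo, 2 * (c n * I) + 2 * I <= 4 * I + e / 2.
  move/cvgrPdist_le : lim1 => /(_ _ e2); apply: filterS => n.
  by rewrite ler_norml => /andP[+ _]; lra.
have {fat} : \forall n \near \oo, ((4 * I - e / 2)%:E < a n)%E.
  have : ((4 * I - e / 2)%:E < limn_einf a)%E.
    by apply: lt_le_trans fat; rewrite lte_fin; lra.
  have -> : limn_einf a = ereal_sup (range (einfs a)).
    by rewrite limn_einf_lim; apply/cvg_lim => //; exact: cvg_einfs_sup.
  move=> /ereal_sup_gt[_ [N _ <-]] hN.
  exists N => // n /= Nn; apply: lt_le_trans hN _.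
  by apply: ereal_inf_lbound; exists n.
apply: filter_app2; near=> n => h1 h2.
have := par n; rewrite -/(a n) -/(d n) -(fineK (an n)) -(fineK (dn n)) -EFinD lee_fin.
move: h1; rewrite -(fineK (an n)) lte_fin => h1.
have := sqint_ge0 (F n \- f); rewrite -/(d n) -(fineK (dn n)) lee_fin => d0 h3.
rewrite ger0_norm//=; move: h3 => /= h3; lra.
Unshelve. all: end_near. Qed.

(** Limits in a real parameter are tested on sequences, to which Fatou's lemma
    applies. *)
Lemma cvg_dnbhs_seq (F : R -> \bar R) (l : \bar R) (a : R) :
  (forall u : nat -> R, (forall n, u n != a) -> u n @[n --> \oo] --> a ->
     F (u n) @[n --> \oo] --> l) ->
  F x @[x --> a^'] --> l.
Proof.
move=> H; apply: contrapT => nF.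
have [A [lA nA]] : exists A, nbhs l A /\ ~ (\forall x \near a^', A (F x)).
  by apply: contrapT => /forallNP nA; apply: nF => A lA; have /not_andP[|/contrapT] := nA A.
have step (n : nat) : exists x, [/\ x != a, `|x - a| < n.+1%:R^-1 & ~ A (F x)].
  apply: contrapT => /forallNP h; apply: nA.
  exists n.+1%:R^-1; first by rewrite /= invr_gt0.
  move=> x /= xa xn; apply: contrapT => nAF; apply: (h x); split=> //.
  by rewrite distrC.
pose u n := projT1 (cid (step n)).
have uP n : [/\ u n != a, `|u n - a| < n.+1%:R^-1 & ~ A (F (u n))].
  by rewrite /u; case: cid.
have ua : u n @[n --> \oo] --> a.
  apply/cvgrPdist_lt => e e0.
  have := near_infty_natSinv_lt (PosNum e0); apply: filterS => n /= ne.
  by have [_ h _] := uP n; rewrite distrC; exact: lt_trans h ne.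
have := H u (fun n => let: And3 h _ _ := uP n in h) ua _ lA.
case=> N _ /(_ N (leqnn N)) /=.
by have [_ _] := uP N.
Qed.

Lemma sqint_cvg (F : R -> R -> R) f (c : R -> R) :
  (forall h, measurable_fun setT (F h)) -> L2 f ->
  (forall x, x != 0 -> F h x @[h --> 0^'] --> f x) ->
  (forall h, h != 0 -> (sqint (F h) <= (c h)%:E * sqint f)%E) ->
  c h @[h --> 0^'] --> (1 : R) ->
  sqint (F h \- f)%R @[h --> 0^'] --> 0%E.
Proof.
move=> mF lf Ff Fc c1; apply: cvg_dnbhs_seq => u u0 ucvg.
have uP : u n @[n --> \oo] --> (0 : R)^'.
  move=> A hA; have : \forall n \near \oo, u n != 0 -> A (u n) := ucvg _ hA.
  by apply: filterS => n /(_ (u0 n)).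
apply: (@sqint_cvg_seq (fun n => F (u n)) f (c \o u)) => //.
- by move=> x x0; exact: cvg_comp uP (Ff x x0).
- by move=> n; exact: Fc (u0 n).
- exact: cvg_comp uP c1.
Qed.

(** The square root is continuous at 0 for extended reals. *)
Lemma sqrte_cvg0 (T : Type) (G : set_system T) (FG : Filter G) (F : T -> \bar R) :
  (forall x, 0 <= F x)%E ->
  F x @[x --> G] --> 0%E -> (F x `^ 2^-1)%E @[x --> G] --> 0%E.
Proof.
move=> F0 /fine_cvgP[Ffin /cvgr0Pnorm_lt Fcvg].
apply/fine_cvgP; split; first by apply: filterS Ffin => x; exact: fin_num_poweR.
apply/cvgr0Pnorm_lt => e e0.
have e2 : 0 < e ^+ 2 by rewrite exprn_gt0.
apply: filterS (Fcvg _ e2) => x /=; rewrite fine_poweR powR12_sqrt ?fine_ge0//.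
rewrite !ger0_norm ?sqrtr_ge0 ?fine_ge0// => h.
by rewrite -(ger0_norm (ltW e0)) -sqrtr_sqr ltr_sqrt.
Qed.

Lemma L2norm_cvg0 (T : Type) (G : set_system T) (FG : Filter G) (F : T -> R -> R) :
  sqint (F x) @[x --> G] --> 0%E -> L2norm (F x) @[x --> G] --> 0%E.
Proof.
under [in X in _ -> X]eq_fun do rewrite L2norm_sqint.
by apply: sqrte_cvg0 => x; exact: sqint_ge0.
Qed.

Lemma sqint_squeeze (G : set_system R) (FG : Filter G) (F : R -> R -> R)
    (c : R -> R) :
  (\forall h \near G, (sqint (F h) <= (c h)%:E)%E) ->
  c h @[h --> G] --> (0 : R) -> sqint (F h) @[h --> G] --> 0%E.
Proof.
move=> Fc c0; apply: (@squeeze_cvge _ _ _ _ (cst 0%E) _ (EFin \o c)).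
- by apply: filterS Fc => h /= ->; rewrite sqint_ge0.
- exact: cvg_cst.
- by apply: cvg_EFin => //; apply: filterE.
Qed.

End SquareIntegral.

(** * The flow of the equation r' = 1 - expR (- r) on the half-line *)

Section HalfFlow.
Context {R : realType}.
Implicit Types t s r x : R.

(** The equation r' = 1 - expR (- r) is linear in the unknown expR r - 1, which
    grows by the factor expR t. *)
Definition hflow t r : R := ln (1 + (expR r - 1) * expR t).
(** The coefficient for which v (hflow t r) + hgain t r * primitive v (hflow t r)
    solves the nonlocal equation. *)
Definition hgain t r : R := expR (- r) * (1 - expR (- t)).

Lemma hflow_arg_ge1 t r : 0 <= r -> 1 <= 1 + (expR r - 1) * expR t.
Proof.
by move=> r0; rewrite lerDl mulr_ge0 ?expR_ge0// subr_ge0 -expR0 ler_expR.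
Qed.

Lemma hflow_arg_gt0 t r : 0 <= r -> 0 < 1 + (expR r - 1) * expR t.
Proof. by move=> r0; apply: lt_le_trans (hflow_arg_ge1 t r0). Qed.

Lemma expR_hflow t r : 0 <= r -> expR (hflow t r) = 1 + (expR r - 1) * expR t.
Proof. by move=> r0; rewrite lnK// posrE hflow_arg_gt0. Qed.

Lemma hflow_ge0 t r : 0 <= r -> 0 <= hflow t r.
Proof. by move=> r0; rewrite ln_ge0// hflow_arg_ge1. Qed.

Lemma hflow_gt0 t r : 0 < r -> 0 < hflow t r.
Proof.
move=> r0; rewrite ln_gt0// ltrDl mulr_gt0 ?expR_gt0// subr_gt0.
by rewrite -expR0 ltr_expR.
Qed.

Lemma hflow_t0 t : hflow t 0 = 0.
Proof. by rewrite /hflow expR0 subrr mul0r addr0 ln1. Qed.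

Lemma hflow_0r r : hflow 0 r = r.
Proof. by rewrite /hflow expR0 mulr1 addrC subrK expRK. Qed.

Lemma hflowD t s r : 0 <= r -> hflow (t + s) r = hflow t (hflow s r).
Proof.
move=> r0; rewrite {2}/hflow expR_hflow// /hflow expRD; congr (ln _); ring.
Qed.

(** The link between the two formulas: the right-hand side is the reciprocal of
    the derivative of hflow t in r. Hence the gain is exactly what is needed for
    the primitive of the solution to be a multiple of the transported one. *)
Lemma hgain_slope t r : 0 <= r -> 1 - hgain t r = expR (hflow t r - r - t).
Proof.
move=> r0; rewrite /hgain !expRD expR_hflow// !expRN.
have e0 : expR r != 0 by rewrite gt_eqF// expR_gt0.
have e1 : expR t != 0 by rewrite gt_eqF// expR_gt0.
by field; rewrite e0 e1.
Qed.

Lemma expR_bounds t : [/\ expR (- `|t|) <= 1, 1 <= expR `|t|,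
  expR (- `|t|) <= expR t & expR t <= expR `|t|].
Proof.
rewrite -expR0 !ler_expR oppr_le0 normr_ge0 ler_norm lerNl.
by split => //; rewrite -normrN ler_norm.
Qed.

Lemma hflow_near t r : 0 <= r -> `|hflow t r - r| <= `|t|.
Proof.
move=> r0; have [h1 h2 h3 h4] := expR_bounds t.
have er : 1 <= expR r by rewrite -expR0 ler_expR.
rewrite ler_distl; apply/andP; split.
  rewrite -ler_expR expR_hflow// expRD; nra.
rewrite -ler_expR expR_hflow// expRD; nra.
Qed.

Lemma hgain_slope_bounds t r : 0 <= r ->
  expR (- `|t|) <= 1 - hgain t r <= expR `|t|.
Proof.
move=> r0; have [h1 h2 h3 h4] := expR_bounds (- t); rewrite normrN in h1 h2 h3 h4.
have er : expR (- r) <= 1 by rewrite -expR0 ler_expR oppr_le0.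
have er0 := expR_ge0 (- r).
by rewrite /hgain; apply/andP; split; nra.
Qed.

Lemma hgain_bound t r : `|hgain t r| <= expR (- r) * (expR `|t| - 1).
Proof.
rewrite /hgain normrM ger0_norm ?expR_ge0// ler_wpM2l ?expR_ge0//.
have [_ h2 h3 h4] := expR_bounds (- t); rewrite normrN in h2 h3 h4.
rewrite ler_norml; apply/andP; split; first lra.
have : expR (-`|t|) * expR `|t| = 1 by rewrite -expRD addNr expR0.
have := expR_gt0 (-`|t|).
nra.
Qed.

Lemma hslope_gt0 t r : 0 <= r -> 0 < 1 - hgain t r.
Proof.
by move=> r0; rewrite hgain_slope// expR_gt0.
Qed.

Lemma is_derive_hflow_r t r : 0 <= r ->
  is_derive r 1 (hflow t) (1 - hgain t r)^-1.
Proof.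
move=> r0; have h := is_derive1_ln (hflow_arg_gt0 t r0).
have -> : hflow t = @ln R \o (fun r => 1 + (expR r - 1) * expR t) by [].
apply: is_derive_eq.
rewrite hgain_slope// -expR_hflow// /GRing.scale/= mulr0 add0r mul1r add0r subr0.
by rewrite -!expRN -!expRD; congr expR; ring.
Qed.

Lemma is_derive_hflow_t t r : 0 <= r ->
  is_derive t 1 (hflow ^~ r) (1 - expR (- hflow t r)).
Proof.
move=> r0; have h := is_derive1_ln (hflow_arg_gt0 t r0).
have -> : hflow ^~ r = @ln R \o (fun t => 1 + (expR r - 1) * expR t) by [].
apply: is_derive_eq.
rewrite /GRing.scale/= expRN expR_hflow//.
by field; rewrite lt0r_neq0// hflow_arg_gt0.
Qed.

Lemma is_derive_hgain_r t r : is_derive r 1 (hgain t) (- hgain t r).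
Proof.
rewrite /hgain; apply: is_derive_eq; rewrite /GRing.scale/=; ring.
Qed.

Lemma is_derive_hgain_t t r :
  is_derive t 1 (hgain ^~ r) (expR (- r) * expR (- t)).
Proof.
rewrite /hgain; apply: is_derive_eq; rewrite /GRing.scale/=; ring.
Qed.

End HalfFlow.

(** * The flow on the line *)

Section Flow.
Context {R : realType}.
Implicit Types t s x : R.

(** On the negative half-line the speed 1 - peakon points towards 0, so that the
    distance to 0 runs through the half-flow backwards in time. *)
Definition flow t x : R := Num.sg x * hflow (Num.sg x * t) `|x|.
Definition gain t x : R := Num.sg x * hgain (Num.sg x * t) `|x|.
(** The derivative of flow t off 0. At the corner it has the value 1, which lies
    between the one-sided derivatives expR t and expR (- t). *)
Definition slope t x : R := (1 - Num.sg x * gain t x)^-1.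

Lemma flowN t x : flow t (- x) = - flow (- t) x.
Proof. by rewrite /flow sgrN normrN mulNr mulrN mulNr. Qed.

Lemma gainN t x : gain t (- x) = - gain (- t) x.
Proof. by rewrite /gain sgrN normrN mulNr mulrN mulNr. Qed.

Lemma slopeN t x : slope t (- x) = slope (- t) x.
Proof. by rewrite /slope gainN sgrN mulrNN. Qed.

Lemma flow_pos t x : 0 <= x -> flow t x = hflow t x.
Proof.
rewrite le_eqVlt => /predU1P[<-|x0]; first by rewrite /flow sgr0 mul0r hflow_t0.
by rewrite /flow gtr0_sg// !mul1r gtr0_norm.
Qed.

Lemma gain_pos t x : 0 < x -> gain t x = hgain t x.
Proof. by move=> x0; rewrite /gain gtr0_sg// !mul1r gtr0_norm. Qed.

Lemma slope_pos t x : 0 < x -> slope t x = (1 - hgain t x)^-1.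
Proof. by move=> x0; rewrite /slope gain_pos// gtr0_sg// mul1r. Qed.

(** Every statement about the flow follows from its half on the positive axis,
    by reversing time together with space. *)
Lemma reflect_ind (P : R -> R -> Prop) :
  (forall t x, P (- t) (- x) -> P t x) -> (forall t x, 0 <= x -> P t x) ->
  forall t x, P t x.
Proof.
move=> PN Pp t x; have [x0|x0] := leP 0 x; first exact: Pp.
by apply: PN; apply: Pp; rewrite oppr_ge0 ltW.
Qed.

Lemma flow_t0 t : flow t 0 = 0.
Proof. by rewrite flow_pos// hflow_t0. Qed.

Lemma flow_0x x : flow 0 x = x.
Proof. by rewrite /flow mulr0 hflow_0r mulr_sg_norm. Qed.

Lemma flow_gt0 t x : 0 < x -> 0 < flow t x.
Proof. by move=> x0; rewrite flow_pos ?ltW// hflow_gt0. Qed.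

Lemma sgr_flow t x : Num.sg (flow t x) = Num.sg x.
Proof.
move: t x; apply: reflect_ind => t x; first
  by rewrite flowN opprK (sgrN x) (sgrN (flow t x)) => /oppr_inj.
rewrite le_eqVlt => /predU1P[<-|x0]; first by rewrite flow_t0.
by rewrite !gtr0_sg// flow_gt0.
Qed.

Lemma flow_neq0 t x : x != 0 -> flow t x != 0.
Proof. by move=> x0; rewrite -sgr_eq0 sgr_flow sgr_eq0. Qed.

Lemma normr_flow t x : `|flow t x| = hflow (Num.sg x * t) `|x|.
Proof.
have [->|x0] := eqVneq x 0; first by rewrite flow_t0 normr0 hflow_t0.
by rewrite /flow normrM normr_sg x0 mul1r ger0_norm// hflow_ge0.
Qed.

Lemma flowD t s x : flow (t + s) x = flow t (flow s x).
Proof. by rewrite {1 2}/flow sgr_flow normr_flow -hflowD// mulrDr. Qed.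

Lemma flowK t x : flow (- t) (flow t x) = x.
Proof. by rewrite -flowD addNr flow_0x. Qed.

Lemma flow_near t x : `|flow t x - x| <= `|t|.
Proof.
move: t x; apply: reflect_ind => t x.
  by rewrite flowN opprK -opprD (normrN t) (normrN (flow t x - x)).
by move=> x0; rewrite flow_pos// hflow_near.
Qed.

Lemma slopeE t x : (slope t x)^-1 = 1 - Num.sg x * gain t x.
Proof. by rewrite /slope invrK. Qed.

Lemma slope_inv t x : x != 0 -> (slope t x)^-1 = 1 - hgain (Num.sg x * t) `|x|.
Proof.
move=> x0; rewrite slopeE /gain mulrA -expr2 sqr_sg x0 mul1r.
by [].
Qed.

Lemma slope_inv_bounds t x : expR (- `|t|) <= (slope t x)^-1 <= expR `|t|.
Proof.
have [->|x0] := eqVneq x 0.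
  rewrite slopeE sgr0 mul0r subr0; have [h1 h2 _ _] := expR_bounds t.
  by rewrite h1 h2.
rewrite slope_inv//.
have := hgain_slope_bounds (Num.sg x * t) (normr_ge0 x).
by rewrite normrM normr_sg x0 mul1r.
Qed.

Lemma slope_bounds t x : expR (- `|t|) <= slope t x <= expR `|t|.
Proof.
have /andP[h1 h2] := slope_inv_bounds t x.
have s0 : 0 < (slope t x)^-1 by apply: lt_le_trans h1; exact: expR_gt0.
rewrite -[slope t x]invrK expRN lef_pV2 ?posrE ?expR_gt0// h2/=.
by rewrite -[leRHS]invrK -expRN lef_pV2 ?posrE ?expR_gt0.
Qed.

Lemma slope_gt0 t x : 0 < slope t x.
Proof.
by have /andP[h _] := slope_bounds t x; apply: lt_le_trans h; exact: expR_gt0.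
Qed.

Lemma gain_bound t x : `|gain t x| <= peakon x * (expR `|t| - 1).
Proof.
have [->|x0] := eqVneq x 0.
  rewrite /gain sgr0 mul0r normr0; apply: mulr_ge0; first exact: expR_ge0.
  by rewrite subr_ge0; have [_ h _ _] := expR_bounds t.
have := hgain_bound (Num.sg x * t) `|x|.
by rewrite /gain !normrM !normr_sg x0 !mul1r.
Qed.

(** The cocycle identity of the slope, the factor by which the primitive of the
    solution is divided along the flow. *)
Lemma slopeD t s x : slope (t + s) x = slope t (flow s x) * slope s x.
Proof.
have [->|x0] := eqVneq x 0.
  by rewrite flow_t0 /slope sgr0 !mul0r subr0 invr1 mulr1.
apply: invr_inj; rewrite invfM !slope_inv ?flow_neq0// sgr_flow normr_flow.
rewrite !hgain_slope ?hflow_ge0// -expRD mulrDr hflowD//.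
congr expR; ring.
Qed.

Lemma gain_slope t x : gain t x = Num.sg x * (1 - (slope t x)^-1).
Proof.
rewrite slopeE opprB addrC subrK mulrA -expr2 sqr_sg.
by have [->|x0] := eqVneq x 0; rewrite ?mul1r// /gain sgr0 mul0r mulr0.
Qed.

End Flow.

(** * Mean values of functions with a corner at the origin *)

Section PiecewiseMVT.
Context {R : realType}.
Implicit Types (F f : R -> R).

Lemma continuous_within_itv F (i : interval R) :
  continuous F -> {within [set` i], continuous F}.
Proof. by move=> cF; apply: continuous_subspaceT. Qed.

(** A corner at 0 does not affect the mean value inequality: an interval that
    contains 0 inside is cut there. *)
Lemma mean_value_bounds F f (m M a b : R) : continuous F ->
  (forall x : R, x != 0 -> is_derive x 1 F (f x)) ->
  (forall x : R, x != 0 -> m <= f x <= M) -> a <= b ->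
  m * (b - a) <= F b - F a <= M * (b - a).
Proof.
move=> cF dF bf.
have nocorner c d : c <= d -> (forall x : R, x \in `]c, d[%R -> x != 0) ->
    m * (d - c) <= F d - F c <= M * (d - c).
  rewrite le_eqVlt => /predU1P[<- _|cd h]; first by rewrite !subrr !mulr0 lexx.
  have [|e ecd ->] := @MVT R F f c d cd _ (continuous_within_itv cF).
    by move=> x xcd; apply: dF; exact: h.
  have /andP[h1 h2] := bf _ (h _ ecd); have dc : 0 <= d - c by rewrite subr_ge0 ltW.
  by rewrite !ler_wpM2r.
move=> ab; have [a0|a0] := leP 0 a.
  apply: nocorner => // x; rewrite in_itv/= => /andP[ax _].
  by rewrite gt_eqF// (le_lt_trans a0).
have [b0|b0] := leP b 0.
  apply: nocorner => // x; rewrite in_itv/= => /andP[_ xb].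
  by rewrite lt_eqF// (lt_le_trans xb).
have /andP[h1 h2] : m * (0 - a) <= F 0 - F a <= M * (0 - a).
  apply: nocorner => [|x]; first exact: ltW.
  by rewrite in_itv/= => /andP[_ x0]; rewrite lt_eqF.
have /andP[h3 h4] : m * (b - 0) <= F b - F 0 <= M * (b - 0).
  apply: nocorner => [|x]; first exact: ltW.
  by rewrite in_itv/= => /andP[x0 _]; rewrite gt_eqF.
by apply/andP; split; lra.
Qed.

Lemma lipschitz_off0 F f (M a b : R) : continuous F ->
  (forall x : R, x != 0 -> is_derive x 1 F (f x)) ->
  (forall x : R, x != 0 -> `|f x| <= M) -> `|F b - F a| <= M * `|b - a|.
Proof.
move=> cF dF bf; wlog ab : a b / a <= b => [H|].
  by have [|/ltW] := leP a b => /H//; rewrite distrC (distrC a).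
rewrite (ger0_norm (_ : 0 <= b - a)) ?subr_ge0// ler_norml -mulNr.
by apply: mean_value_bounds ab => // x /bf; rewrite ler_norml.
Qed.

Lemma derive0_cst F : continuous F ->
  (forall x : R, x != 0 -> is_derive x 1 F 0) -> forall x, F x = F 0.
Proof.
move=> cF dF x; apply/eqP; rewrite -subr_eq0 -normr_le0.
rewrite -[leRHS](mul0r `|x - 0|).
by apply: (@lipschitz_off0 F (cst 0)) => // y _; rewrite normr0.
Qed.

Lemma is_derive_continuous F (df x : R) :
  is_derive x 1 F df -> {for x, continuous F}.
Proof.
move=> [dF _]; apply: differentiable_continuous; exact/derivable1_diffP.
Qed.

Lemma is_derive_reflect F (df x : R) :
  is_derive (- x) 1 (F \o -%R) df -> is_derive x 1 F (- df).
Proof.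
move=> h; have -> : F = (F \o -%R) \o -%R by apply/funext => y /=; rewrite opprK.
by apply: is_derive_eq; rewrite mulrN1.
Qed.

End PiecewiseMVT.

(** * Differentiability of the flow *)

Section FlowCalculus.
Context {R : realType}.
Implicit Types t s x : R.

Lemma peakon0 : peakon (0 : R) = 1.
Proof. by rewrite /peakon normr0 oppr0 expR0. Qed.

Lemma peakonN x : peakon (- x) = peakon x.
Proof. by rewrite /peakon normrN. Qed.

Lemma peakon_bounds x : 0 < peakon x <= 1.
Proof. by rewrite /peakon expR_gt0 -expR0 ler_expR oppr_le0 normr_ge0. Qed.

Lemma continuous_peakon : continuous (@peakon R).
Proof.
move=> x; apply: (@continuous_comp _ _ _ (fun x : R => - `|x|) expR).
  by apply: continuousN; exact: norm_continuous.
exact: continuous_expR.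
Qed.

Lemma is_derive_flow_t t x : is_derive t 1 (flow ^~ x) (1 - peakon (flow t x)).
Proof.
rewrite /peakon normr_flow.
have [->|x0] := eqVneq x 0.
  rewrite sgr0 mul0r normr0 hflow_t0 oppr0 expR0 subrr.
  rewrite (_ : flow ^~ 0 = cst 0); first exact: is_derive_cst.
  by apply/funext => s; rewrite flow_t0.
have h := is_derive_hflow_t (Num.sg x * t) (normr_ge0 x).
have -> : flow ^~ x = fun t => Num.sg x * ((hflow ^~ `|x|) \o (fun t => Num.sg x * t)) t.
  by [].
apply: is_derive_eq.
have s2 : Num.sg x * Num.sg x = 1 by rewrite -expr2 sqr_sg x0.
transitivity (Num.sg x * Num.sg x * (1 - expR (- hflow (Num.sg x * t) `|x|))).
  by rewrite /GRing.scale/=; ring.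
by rewrite s2 mul1r.
Qed.

Lemma near_pos x : 0 < x -> \forall y \near x, 0 < y.
Proof. by move=> x0; exact: lt_nbhsr. Qed.

Lemma is_derive_flow_x t x : x != 0 -> is_derive x 1 (flow t) (slope t x).
Proof.
move: t x; apply: reflect_ind => t x.
  rewrite oppr_eq0 => h x0; rewrite -[slope t x]opprK; apply: is_derive_reflect.
  have {}h := h x0; rewrite slopeN opprK in h.
  rewrite (_ : _ \o _ = - flow (- t)); first exact: is_deriveN.
  by apply/funext => y /=; rewrite flowN.
rewrite le_eqVlt => /predU1P[<-|x0 _]; first by rewrite eqxx.
rewrite slope_pos//; apply: near_eq_is_derive (is_derive_hflow_r t (ltW x0)).
by apply: filterS (near_pos x0) => y /ltW y0; rewrite flow_pos.
Qed.

Lemma is_derive_gain_x t x : x != 0 ->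
  is_derive x 1 (gain t) (- (Num.sg x * gain t x)).
Proof.
move: t x; apply: reflect_ind => t x.
  rewrite oppr_eq0 => h x0; apply: is_derive_reflect.
  have {}h := h x0; rewrite sgrN gainN opprK mulrNN in h.
  rewrite (_ : _ \o _ = - gain (- t)).
    by rewrite -[Num.sg x * _]opprK; exact: is_deriveN.
  by apply/funext => y /=; rewrite gainN.
rewrite le_eqVlt => /predU1P[<-|x0 _]; first by rewrite eqxx.
rewrite gtr0_sg// mul1r gain_pos//.
apply: near_eq_is_derive (is_derive_hgain_r t x).
by apply: filterS (near_pos x0) => y y0; rewrite gain_pos.
Qed.

Lemma flow_cvg_t0 x : flow t x @[t --> (0 : R)] --> x.
Proof.
have := is_derive_continuous (is_derive_flow_t 0 x).
by rewrite /prop_for /continuous_at flow_0x.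
Qed.

Lemma normr_flow_le t x : `|flow t x| <= expR `|t| * (expR `|x| - 1).
Proof.
rewrite normr_flow; set s := _ * t.
have st : expR s <= expR `|t|.
  rewrite ler_expR (le_trans (ler_norm _))// normrM normr_sg.
  by case: (x != 0); rewrite ?mul1r ?mul0r.
have h1 := expR_ge1Dx (hflow s `|x|); rewrite expR_hflow// in h1.
have h2 : 1 <= expR `|x| by rewrite -expR0 ler_expR.
nra.
Qed.

Lemma continuous_flow t : continuous (flow t).
Proof.
move=> x; have [->|x0] := eqVneq x 0; last first.
  exact: is_derive_continuous (is_derive_flow_x t x0).
rewrite /continuous_at flow_t0; apply/cvgr0Pnorm_le => e e0.
have : {for (0 : R), continuous (fun y : R => expR `|t| * (expR `|y| - 1))}.
  apply: continuousM; first exact: cvg_cst.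
  apply: continuousB; last exact: cvg_cst.
  apply: (@continuous_comp _ _ _ (fun x : R => `|x|) expR).
    exact: norm_continuous.
  exact: continuous_expR.
rewrite /prop_for /continuous_at normr0 expR0 subrr mulr0.
move=> /cvgr0Pnorm_le /(_ _ e0); apply: filterS => y h.
apply: le_trans (normr_flow_le t y) _.
exact: le_trans (ler_norm _) h.
Qed.

(** The derivative off 0 is the slope, which is positive and at most expR |t|. As
    flow (- t) is the inverse, the flow is bi-Lipschitz. *)
Lemma flow_bounds t a b : a <= b ->
  0 <= flow t b - flow t a <= expR `|t| * (b - a).
Proof.
move=> ab; rewrite -(mul0r (b - a)).
apply: (@mean_value_bounds _ (flow t) (slope t)) => //.
- exact: continuous_flow.
- by move=> x x0; exact: is_derive_flow_x.
- move=> x _; have /andP[_ ->] := slope_bounds t x.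
  by rewrite ltW// slope_gt0.
Qed.

Lemma flow_le t : {homo (@flow R t) : a b / a <= b}.
Proof.
by move=> a b ab; have /andP[h _] := flow_bounds t ab; rewrite -subr_ge0.
Qed.

Lemma flowNK t x : flow t (flow (- t) x) = x.
Proof. by rewrite -{1}[t]opprK flowK. Qed.

End FlowCalculus.

(** * Change of variables along the flow *)

Section FlowMeasure.
Context {R : realType}.
Notation mu := (@lebesgue_measure R).
Implicit Types (f : R -> R) (t : R).

Lemma measurable_flow t : measurable_fun setT (flow t : R -> R).
Proof. by apply: continuous_measurable_fun; exact: continuous_flow. Qed.

(** Lebesgue measure is an infimum over countable coverings by intervals, and on
    intervals the estimate holds because the inverse flow (- t) is Lipschitz with
    constant expR |t|. *)
Lemma image_measure_le t (A : set R) : measurable A ->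
  (mu (flow t @^-1` A) <= (expR `|t|)%:E * mu A)%E.
Proof.
move=> mA.
have mpre B : measurable B -> measurable (flow t @^-1` B).
  by move=> mB; rewrite -[X in measurable X]setTI; exact: measurable_flow.
have itv (a b : R) : (mu (flow t @^-1` `]a, b]) <= (expR `|t|)%:E * wlength idfun `]a, b]%classic)%E.
  have sub : flow t @^-1` `]a, b] `<=` `]flow (- t) a, flow (- t) b].
    move=> x /=; rewrite !in_itv/= => /andP[ax xb]; apply/andP; split.
      rewrite ltNge; apply: contraTN ax => /(flow_le t).
      by rewrite flowNK -leNgt.
    by rewrite -(flowK t x); exact: flow_le.
  apply: (@le_trans _ _ (mu `]flow (- t) a, flow (- t) b])).
    apply: le_measure; rewrite ?inE//; exact: mpre.
  rewrite lebesgue_measure_itv wlength_itv/= !lte_fin.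
  have [ab|ba] := ltP a b.
    have /andP[h1 h2] := flow_bounds (- t) (ltW ab); rewrite normrN in h2.
    case: ifPn => _; rewrite -!EFinD -EFinM lee_fin//.
    by rewrite mulr_ge0 ?expR_ge0// subr_ge0 ltW.
  by rewrite ltNge (flow_le (- t) ba)/= mule0.
rewrite muleC -lee_pdivrMr ?expR_gt0// [leRHS]/lebesgue_measure.
apply: le_ereal_inf_tmp => _ [F [Fm AF] <-].
rewrite lee_pdivrMr ?expR_gt0// muleC -nneseriesZl//.
apply: (@le_trans _ _ (\sum_(k <oo) mu (flow t @^-1` (F k)))%E).
  apply: measure_sigma_subadditive.
  - by move=> k; apply: mpre; apply: sub_sigma_algebra; exact: Fm.
  - exact: mpre.
  - by rewrite -preimage_bigcup; exact: preimage_subset.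
apply: lee_nneseries => [k _ _|k _]; first exact: measure_ge0.
by have [[a b] _ <-] := Fm k; exact: itv.
Qed.

(** Change of variables as an inequality: the left-hand side is an integral for
    the image of Lebesgue measure under the flow. *)
Lemma sqint_flow t f : measurable_fun setT f ->
  (sqint (f \o flow t) <= (expR `|t|)%:E * sqint f)%E.
Proof.
move=> mf.
pose c : {nonneg R} := NngNum (expR_ge0 `|t|).
pose pf : {measure set (measurableTypeR R) -> \bar R} :=
  pushforward mu (flow t : measurableTypeR R -> measurableTypeR R).
pose m1 := pf (measurable_flow t).
pose m2 : {measure set (measurableTypeR R) -> \bar R} := mscale c mu.
have h : (forall S, measurable S -> m1 S <= m2 S)%E.
  by move=> S mS; exact: image_measure_le.
have f2 x : (0 <= (f x ^+ 2)%:E)%E by rewrite lee_fin sqr_ge0.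
have := @ge0_le_measure_integral _ _ _ m1 m2 h (fun x => (f x ^+ 2)%:E) setT measurableT f2 (measurable_sqr mf).
rewrite ge0_integral_mscale//; last exact: measurable_sqr.
rewrite ge0_integral_pushforward//; last exact: measurable_sqr.
exact: measurable_flow.
Qed.

Lemma L2_flow t f : L2 f -> L2 (f \o flow t).
Proof.
move=> /L2P[mf lf]; apply/L2P; split.
  by apply: measurableT_comp => //; exact: measurable_flow.
by apply: le_lt_trans (sqint_flow t mf) _; rewrite lte_mul_pinfty ?lee_fin ?expR_ge0.
Qed.

End FlowMeasure.

(** * Primitives of continuous functions *)

Section Primitive.
Context {R : realType}.
Notation mu := (@lebesgue_measure R).
Implicit Types (v F : R -> R) (x y : R).

Lemma continuous_itv_integrable v (a b : R) : continuous v ->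
  mu.-integrable `[a, b] (EFin \o v).
Proof.
move=> cv; apply: continuous_compact_integrable; first exact: segment_compact.
exact: continuous_subspaceT.
Qed.

Lemma primitive0 v : primitive v 0 = 0.
Proof. by rewrite /primitive subrr. Qed.

(** With the base point moved to the left of both 0 and x, the oriented integral
    becomes one over an interval with a variable right end, to which the
    fundamental theorem of calculus applies. *)
Lemma primitive_itvB v (a x : R) : continuous v -> a <= x -> a <= 0 ->
  primitive v x = \int[mu]_(y in `[a, x]) v y - \int[mu]_(y in `[a, 0]) v y.
Proof.
move=> cv ax a0; have iv b := continuous_itv_integrable a b cv.
have split c d : a <= c -> c <= d ->
    \int[mu]_(y in `[a, d]) v y - \int[mu]_(y in `[a, c]) v y =
    \int[mu]_(y in `[c, d]) v y.
  move=> ac cd; rewrite (Rintegral_itvB (iv d)) ?bnd_simp//.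
  rewrite Rintegral_itv_obnd_cbnd//.
  apply: integrableS (continuous_itv_integrable c d cv) => //.
  by apply: subset_itvr; rewrite bnd_simp.
have empty c d : c < d -> \int[mu]_(y in `[d, c]) v y = 0.
  by move=> cd; rewrite set_itv_ge ?Rintegral_set0// bnd_simp -ltNge.
rewrite /primitive; have [x0|x0|<-] := ltgtP 0 x; last by rewrite !subrr.
  by rewrite (empty 0 x)// subr0 split// ltW.
by rewrite (empty x 0)// sub0r -(split x 0)// ?opprB// ltW.
Qed.

Lemma is_derive_primitive v x : continuous v -> is_derive x 1 (primitive v) (v x).
Proof.
move=> cv; pose a := - `|x| - 1.
have ax : a < x by rewrite /a; have := ler_norm (- x); rewrite normrN; lra.
have a0 : a < 0 by rewrite /a; have := normr_ge0 x; lra.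
have x1 : x < x + 1 by rewrite ltrDl.
have [dF F'] := @continuous_FTC1_closed R v a x (x + 1) x1
  (continuous_itv_integrable _ _ cv) ax (cv x).
have h : is_derive x 1 (fun y => \int[mu]_(z in `[a, y]) v z) (v x).
  by apply: DeriveDef; [exact: dF|rewrite -derive1E F'].
have {}h : is_derive x 1 (fun y => \int[mu]_(z in `[a, y]) v z
    - \int[mu]_(z in `[a, 0]) v z) (v x).
  by rewrite -[v x]subr0; apply: is_deriveB.
apply: near_eq_is_derive h.
by apply: filterS (lt_nbhsr ax) => y ay; rewrite (primitive_itvB cv (ltW ay) (ltW a0)).
Qed.

Lemma continuous_primitive v : continuous v -> continuous (primitive v).
Proof. by move=> cv x; exact: is_derive_continuous (is_derive_primitive x cv). Qed.

(** The difference of two candidates is continuous with zero derivative off 0,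
    hence constant. *)
Lemma primitive_unique v F : continuous v -> continuous F -> F 0 = 0 ->
  (forall x, x != 0 -> is_derive x 1 F (v x)) -> primitive v = F.
Proof.
move=> cv cF F0 dF; apply/funext => x.
have := @derive0_cst _ (primitive v - F) _ _ x.
rewrite !fctE primitive0 F0 subrr => /(_ _ _)/subr0_eq; apply => //.
  by move=> y; apply: continuousB; [exact: continuous_primitive|exact: cF].
move=> y y0; rewrite -(subrr (v y)); apply: is_deriveB; last exact: dF.
exact: is_derive_primitive.
Qed.

Lemma continuous_reflect v : continuous v -> continuous (v \o -%R).
Proof.
move=> cv x; apply: continuous_comp; last exact: cv.
exact: opp_continuous.
Qed.

Lemma primitive_reflect v x : continuous v ->
  primitive (v \o -%R) x = - primitive v (- x).
Proof.
move=> cv; have -> // : primitive (v \o -%R) = - (primitive v \o -%R).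
apply: primitive_unique; first exact: continuous_reflect.
- move=> y; apply: continuousN; apply: continuous_reflect.
  exact: continuous_primitive.
- by rewrite fctE/= oppr0 primitive0 oppr0.
move=> y _; have h := is_derive_primitive (- y) cv.
by apply: is_derive_eq; rewrite mulrN1 opprK.
Qed.

Lemma primitiveB v w : continuous v -> continuous w ->
  primitive (v \- w) = primitive v \- primitive w.
Proof.
move=> cv cw; apply: primitive_unique.
- by move=> y; apply: continuousB; [exact: cv|exact: cw].
- by move=> y; apply: continuousB; exact: continuous_primitive.
- by rewrite /= !primitive0 subrr.
- by move=> y _; apply: is_deriveB; exact: is_derive_primitive.
Qed.

Lemma primitive_lip v (M : R) x y : continuous v -> (forall z, `|v z| <= M) ->
  `|primitive v y - primitive v x| <= M * `|y - x|.
Proof.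
move=> cv vM; apply: (@lipschitz_off0 _ _ v) => //.
  exact: continuous_primitive.
by move=> z _; exact: is_derive_primitive.
Qed.

Lemma primitive_bound v (M : R) x : continuous v -> (forall z, `|v z| <= M) ->
  `|primitive v x| <= M * `|x|.
Proof.
by move=> cv vM; have := primitive_lip 0 x cv vM; rewrite primitive0 !subr0.
Qed.

(** The decay of peakon compensates the linear growth of a primitive, and half
    of it is left over. *)
Lemma peakon_growth x : peakon x * `|x| <= 2 * expR (- (`|x| / 2)).
Proof.
have -> : peakon x = expR (- (`|x| / 2)) * expR (- (`|x| / 2)).
  by rewrite -expRD /peakon; congr expR; field.
have h := expR_ge1Dx (`|x| / 2); have e0 := expR_gt0 (- (`|x| / 2)).
have e1 : expR (- (`|x| / 2)) * expR (`|x| / 2) = 1 by rewrite -expRD addNr expR0.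
have x0 := normr_ge0 x.
nra.
Qed.

End Primitive.

(** * Piecewise continuously differentiable functions *)

Section PiecewiseC1.
Context {R : realType}.
Implicit Types (v g : R -> R) (t x : R).

(** The derivative on the open half-line extends continuously to 0. Continuity of
    g at 0 is two-sided: compositions with the flow then need no one-sided
    limits. *)
Definition half_C1 v g : Prop :=
  (forall x, 0 < x -> is_derive x 1 v (g x)) /\
  (forall x, 0 <= x -> {for x, continuous g}).

Lemma is_derive_derive1 v (d x : R) : is_derive x 1 v d -> derive1 v x = d.
Proof. by move=> [_ <-]; rewrite derive1E. Qed.

Lemma derive1_is_derive v x : derivable v x 1 -> is_derive x 1 v (derive1 v x).
Proof. by move=> dv; apply: DeriveDef => //; rewrite derive1E. Qed.

Lemma C10_continuous v : C10 v -> continuous v.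
Proof. by case. Qed.

Lemma C10_is_derive v x : C10 v -> x != 0 -> is_derive x 1 v (derive1 v x).
Proof. by move=> [_ h _ _] /h[dv _]; exact: derive1_is_derive. Qed.

Lemma bounded_onP v (D : set R) : [bounded v x | x in D] <->
  exists2 M, 0 <= M & forall x, D x -> `|v x| <= M.
Proof.
split.
  move=> [M [_ /(_ (`|M| + 1))]] h; exists (`|M| + 1); first by rewrite addr_ge0.
  by move=> x Dx; apply: h => //; have := ler_norm M; lra.
by move=> [M _ vM]; exists M; split; [exact: num_real|move=> N MN x Dx /=; rewrite (le_trans (vM _ Dx))// ltW].
Qed.

Lemma C10_bounded v : C10 v -> exists2 M, 0 <= M & forall x, `|v x| <= M.
Proof.
by move=> [_ _ _ [/bounded_onP[M M0 vM] _]]; exists M => // x; exact: vM.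
Qed.

Lemma C10_derive_bounded v : C10 v ->
  exists2 M, 0 <= M & forall x, x != 0 -> `|derive1 v x| <= M.
Proof. by move=> [_ _ _ [_ /bounded_onP]]. Qed.

Lemma derive1_reflect v x : derivable v (- x) 1 ->
  is_derive x 1 (v \o -%R) (- derive1 v (- x)).
Proof.
move=> /derive1_is_derive h.
by apply: is_derive_eq; rewrite mulrN1.
Qed.

(** To the left of 0 the derivative is replaced by its right limit at 0. *)
Lemma C10_half v : C10 v -> exists g, half_C1 v g.
Proof.
move=> [cv dv [_ /cvg_ex[l rl]] _].
exists (fun x => if 0 < x then derive1 v x else l); split => x x0.
  rewrite x0; apply: derive1_is_derive.
  by have [|//] := dv x; rewrite gt_eqF.
move: x0; rewrite le_eqVlt => /predU1P[<-|x0]; last first.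
  rewrite /prop_for /continuous_at x0.
  have [|_ c] := dv x; first by rewrite gt_eqF.
  apply: cvg_trans c; apply: near_eq_cvg.
  by apply: filterS (near_pos x0) => y /= ->.
rewrite /prop_for /continuous_at ltxx.
apply/cvgrPdist_lt => e e0; move/cvgrPdist_lt : rl => /(_ _ e0) rl.
have {}rl : \forall y \near (0 : R), 0 < y -> `|l - derive1 v y| < e by exact: rl.
by apply: filterS rl => y /=; case: ifP => [_|_ _]; [exact|rewrite subrr normr0].
Qed.

Lemma near_cvg (T : Type) (F : set_system T) (FF : Filter F) (f g : T -> R) (l : R) :
  (\forall x \near F, f x = g x) -> g x @[x --> F] --> l -> f x @[x --> F] --> l.
Proof.
move=> fg; apply: cvg_trans; apply: near_eq_cvg.
by apply: filterS fg => x ->.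
Qed.

Lemma near_neq0 x : x != 0 -> \forall y \near x, y != 0.
Proof.
move=> x0; apply: open_nbhs_nbhs; split => //; exact: open_neq.
Qed.

Lemma C10_reflect v : C10 v -> C10 (v \o -%R).
Proof.
move=> vC; have [cv dv [lv rv] [/bounded_onP[M M0 vM] /bounded_onP[N N0 vN]]] := vC.
have dr x : x != 0 -> derive1 (v \o -%R) x = - derive1 v (- x).
  move=> x0; apply: is_derive_derive1; apply: derive1_reflect.
  by have [|//] := dv (- x); rewrite oppr_eq0.
split.
- exact: continuous_reflect.
- move=> x x0; have nx0 : - x != 0 by rewrite oppr_eq0.
  have [d c] := dv _ nx0; split.
    by have [] := derive1_reflect d.
  rewrite /prop_for /continuous_at dr//.
  have h : {for x, continuous (fun y => - derive1 v (- y))}.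
    apply: continuousN; apply: (@continuous_comp _ _ _ (-%R) (derive1 v)) => //.
    exact: opp_continuous.
  apply: cvg_trans h; apply: near_eq_cvg.
  by apply: filterS (near_neq0 x0) => y /dr.
- split.
  + apply/cvg_ex; move/cvg_ex : rv => [l rl]; exists (- l).
    rewrite cvg_at_leftNP oppr0.
    apply: near_cvg (cvgN rl).
    have : \forall y \near 0^'+, (0 : R) < y by exact: nbhs_right_gt.
    by apply: filterS => y y0; rewrite /= dr ?opprK// oppr_eq0 gt_eqF.
  + apply/cvg_ex; move/cvg_ex : lv => [l ll]; exists (- l).
    rewrite cvg_at_rightNP oppr0.
    apply: near_cvg (cvgN ll).
    have : \forall y \near 0^'-, y < (0 : R) by exact: nbhs_left_lt.
    by apply: filterS => y y0; rewrite /= dr ?opprK// oppr_eq0 lt_eqF.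
- split; apply/bounded_onP.
    by exists M => // x _ /=; exact: vM.
  by exists N => // x x0; rewrite dr// normrN; apply: vN => /=; rewrite oppr_eq0.
Qed.

Lemma half_C1_derive1 v g x : half_C1 v g -> 0 < x -> derive1 v x = g x.
Proof. by move=> [dg _] x0; apply: is_derive_derive1; exact: dg. Qed.

Lemma half_C1_continuous v g x : half_C1 v g -> 0 < x ->
  {for x, continuous (derive1 v)}.
Proof.
move=> vg x0; rewrite /prop_for /continuous_at (half_C1_derive1 vg x0).
have := vg.2 x (ltW x0); apply: cvg_trans; apply: near_eq_cvg.
by apply: filterS (near_pos x0) => y y0; rewrite (half_C1_derive1 vg y0).
Qed.

Lemma half_C1_cvg v g : half_C1 v g -> derive1 v x @[x --> 0^'+] --> g 0.
Proof.
move=> vg; have /cvg_at_right_filter := vg.2 0 (lexx 0).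
apply: cvg_trans; apply: near_eq_cvg.
have : \forall y \near 0^'+, (0 : R) < y by exact: nbhs_right_gt.
by apply: filterS => y y0; rewrite (half_C1_derive1 vg y0).
Qed.

(** Membership in C10 is checked on the two half-lines separately, on the
    negative one after reflection. *)
Lemma C10_intro v g1 g2 M N : continuous v -> (forall x, `|v x| <= M) ->
  half_C1 v g1 -> half_C1 (v \o -%R) g2 ->
  (forall x, x != 0 -> `|derive1 v x| <= N) -> C10 v.
Proof.
move=> cv vM vg1 vg2 vN.
have rr : (v \o -%R) \o -%R = v by apply/funext => y /=; rewrite opprK.
have dn y : y < 0 -> derivable v y 1 /\ derive1 v y = - derive1 (v \o -%R) (- y).
  move=> y0; have [d _] : is_derive (- y) 1 (v \o -%R) (g2 (- y)).
    by apply: vg2.1; rewrite oppr_gt0.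
  have h : is_derive y 1 v (- derive1 (v \o -%R) (- y)).
    by apply: is_derive_reflect; exact: derive1_is_derive.
  by split; [case: h|exact: is_derive_derive1 h].
split => //.
- move=> x; rewrite neq_lt => /orP[x0|x0]; last first.
    by split; [have [] := vg1.1 _ x0|exact: half_C1_continuous vg1 x0].
  have [d dE] := dn _ x0; split; first exact: d.
  have nx0 : 0 < - x by rewrite oppr_gt0.
  have h : {for x, continuous (fun y => - derive1 (v \o -%R) (- y))}.
    apply: continuousN; apply: (@continuous_comp _ _ _ (-%R) (derive1 (v \o -%R))).
      exact: opp_continuous.
    exact: half_C1_continuous vg2 nx0.
  rewrite /prop_for /continuous_at dE; apply: cvg_trans h; apply: near_eq_cvg.
  have : \forall y \near x, y < 0 by exact: lt_nbhsl.
  by apply: filterS => y /dn[_ ->].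
- split; apply/cvg_ex; last by exists (g1 0); exact: half_C1_cvg.
  exists (- g2 0); rewrite cvg_at_leftNP oppr0.
  apply: near_cvg (cvgN (half_C1_cvg vg2)).
  have : \forall y \near 0^'+, (0 : R) < y by exact: nbhs_right_gt.
  apply: filterS => y y0 /=; have ny : - y < 0 by rewrite oppr_lt0.
  by have [_ ->] := dn _ ny; rewrite opprK.
- split; apply/bounded_onP.
    by exists M; [exact: le_trans (vM 0)|move=> x _; exact: vM].
  exists `|N|; first exact: normr_ge0.
  by move=> x x0; apply: le_trans (vN _ x0) _; exact: ler_norm.
Qed.

End PiecewiseC1.

(** * The evolution operators *)

Section Evolution.
Context {R : realType}.
Implicit Types (v g : R -> R) (t s x : R).

(** Variation of constants along the characteristics of the transport part. *)
Definition evol t v x : R := v (flow t x) + gain t x * primitive v (flow t x).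

Definition evol_dx t v x : R := derive1 v (flow t x) * slope t x
  - Num.sg x * gain t x * primitive v (flow t x)
  + gain t x * (v (flow t x) * slope t x).

Lemma evolN t v x : continuous v -> evol t v (- x) = evol (- t) (v \o -%R) x.
Proof.
move=> cv; rewrite /evol flowN gainN primitive_reflect//=.
by rewrite mulrN mulNr.
Qed.

Lemma evol0 v : evol 0 v = v.
Proof.
apply/funext => x; rewrite /evol flow_0x /gain mulr0 /hgain oppr0 expR0 subrr.
by rewrite !mulr0 mul0r addr0.
Qed.

Lemma evol_t0 t v : evol t v 0 = v 0.
Proof. by rewrite /evol flow_t0 primitive0 mulr0 addr0. Qed.

(** The gain decays faster than the primitive grows. *)
Lemma gain_primitive_bound v (M : R) t x : continuous v -> (forall z, `|v z| <= M) ->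
  `|gain t x * primitive v (flow t x)| <=
    (expR `|t| - 1) * M * (2 + `|t|) * expR (- (`|x| / 2)).
Proof.
move=> cv vM; rewrite normrM.
have M0 : 0 <= M by exact: le_trans (vM 0).
have h1 := gain_bound t x; have h2 := primitive_bound (flow t x) cv vM.
have h3 := flow_near t x; have h4 := peakon_growth x.
have [_ e1 _ _] := expR_bounds t.
have h5 : `|flow t x| <= `|x| + `|t|.
  by rewrite -[flow t x](subrK x) addrC (le_trans (ler_normD _ _))// lerD2l.
have h6 : peakon x <= expR (- (`|x| / 2)).
  by rewrite ler_expR lerN2 ler_pdivrMr// ler_peMr// ler1n.
apply: le_trans (ler_pM (normr_ge0 _) (normr_ge0 _) h1 h2) _.
apply: (@le_trans _ _ ((expR `|t| - 1) * M * (peakon x * (`|x| + `|t|)))).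
  rewrite [leLHS](_ : _ = (expR `|t| - 1) * M * (peakon x * `|flow t x|)); last by ring.
  apply: ler_wpM2l; first by rewrite mulr_ge0// subr_ge0.
  by apply: ler_wpM2l => //; exact: expR_ge0.
rewrite -[leRHS]mulrA; apply: ler_wpM2l; first by rewrite mulr_ge0// subr_ge0.
rewrite mulrDr mulrDl lerD// mulrC ler_wpM2l//.
Qed.

Lemma continuous_evol t v : continuous v -> continuous (evol t v).
Proof.
move=> cv x; have cf : {for x, continuous (v \o flow t)}.
  by apply: continuous_comp; [exact: continuous_flow|exact: cv].
have cp : {for x, continuous (primitive v \o flow t)}.
  by apply: continuous_comp; [exact: continuous_flow|exact: continuous_primitive].
have -> : evol t v = (v \o flow t) + gain t * (primitive v \o flow t) by [].
apply: continuousD => //; have [x0|x0] := eqVneq x 0; last first.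
  apply: continuousM => //.
  exact: is_derive_continuous (is_derive_gain_x t x0).
rewrite x0 in cp *.
have g0 : (gain t * (primitive v \o flow t)) 0 = 0.
  by rewrite -[LHS]/(gain t 0 * primitive v (flow t 0)) flow_t0 primitive0 mulr0.
suff h : gain t y * primitive v (flow t y) @[y --> (0 : R)] --> (0 : R).
  by move: h; rewrite -[X in _ --> X]g0.
move: cp; rewrite /prop_for /continuous_at/= flow_t0 primitive0 => cp.
have {}cp : (expR `|t| * primitive v (flow t y)) @[y --> (0 : R)] --> (0 : R).
  by rewrite -[X in _ --> X](mulr0 (expR `|t|)); exact: cvgMl_tmp cp.
apply/cvgr0Pnorm_le => e e0; move/cvgr0Pnorm_le : cp => /(_ _ e0).
apply: filterS => y; apply: le_trans.
rewrite (normrM (gain t y)) [leRHS]normrM.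
apply: ler_wpM2r => //; rewrite [leRHS]ger0_norm ?expR_ge0//.
apply: le_trans (gain_bound t y) _.
have /andP[p0 p1] := peakon_bounds y; have [_ e1 _ _] := expR_bounds t.
nra.
Qed.

Lemma is_derive_evol_x t v x : C10 v -> x != 0 ->
  is_derive x 1 (evol t v) (evol_dx t v x).
Proof.
move=> vC x0.
have h1 := C10_is_derive vC (flow_neq0 t x0).
have h2 := is_derive_flow_x t x0.
have h3 := is_derive_primitive (flow t x) (C10_continuous vC).
have h4 := is_derive_gain_x t x0.
apply: is_derive_eq (is_deriveD (is_derive1_comp h1 h2)
  (is_deriveM h4 (is_derive1_comp h3 h2))) _.
rewrite /evol_dx /GRing.scale/=; ring.
Qed.

End Evolution.

(** * Group property and pointwise equation *)

Section EvolutionGroup.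
Context {R : realType}.
Implicit Types (v g : R -> R) (t s x : R).

Lemma near_sgr x : x != 0 -> \forall y \near x, Num.sg y = Num.sg x.
Proof.
rewrite neq_lt => /orP[x0|x0].
  have : \forall y \near x, y < 0 by exact: lt_nbhsl.
  by apply: filterS => y y0; rewrite !ltr0_sg.
by apply: filterS (near_pos x0) => y y0; rewrite !gtr0_sg.
Qed.

Lemma sgr_sqr x : x != 0 -> Num.sg x * Num.sg x = 1.
Proof. by move=> x0; rewrite -expr2 sqr_sg x0. Qed.

(** Along the flow, the primitive of the solution is only rescaled: in terms of
    the primitive, the nonlocal evolution becomes a transport equation. *)
Lemma primitive_evol t v x : continuous v ->
  primitive (evol t v) x = primitive v (flow t x) * (slope t x)^-1.
Proof.
move=> cv.
(* The right-hand side, with the reciprocal of the slope written out so that it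
   can be differentiated. *)
pose W y := primitive v (flow t y) - Num.sg y * (gain t y * primitive v (flow t y)).
have -> : primitive v (flow t x) * (slope t x)^-1 = W x by rewrite slopeE /W; ring.
suff -> : primitive (evol t v) = W by [].
have cV : continuous (primitive v \o flow t).
  by move=> y; apply: continuous_comp; [exact: continuous_flow|exact: continuous_primitive].
have cG : continuous (fun y => gain t y * primitive v (flow t y)).
  have -> : (fun y => gain t y * primitive v (flow t y)) = evol t v - (v \o flow t).
    by apply/funext => y; rewrite !fctE /evol /= addrC addKr.
  move=> y; apply: continuousB; first exact: continuous_evol.
  by apply: continuous_comp; [exact: continuous_flow|exact: cv].
have W0 : W 0 = 0 by rewrite /W sgr0 mul0r flow_t0 primitive0 subrr.
have dW (y : R) : y != 0 -> is_derive y 1 W (evol t v y).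
  move=> y0.
  have h2 := is_derive_flow_x t y0.
  have h3 := is_derive_primitive (flow t y) cv.
  have h4 := is_derive_gain_x t y0.
  pose Wy := (primitive v \o flow t) - cst (Num.sg y) * (gain t * (primitive v \o flow t)).
  suff h : is_derive y 1 Wy (evol t v y).
    apply: near_eq_is_derive h.
    by apply: filterS (near_sgr y0) => z zy; rewrite /W zy.
  apply: is_derive_eq; rewrite /GRing.scale/=.
  have s2 := sgr_sqr y0.
  have sl : slope t y * (1 - Num.sg y * gain t y) = 1.
    by rewrite -slopeE divff// gt_eqF// slope_gt0.
  set V := primitive v (flow t y) in h3 *.
  transitivity (v (flow t y) * (slope t y * (1 - Num.sg y * gain t y))
    + Num.sg y * Num.sg y * gain t y * V); last by rewrite sl s2 mulr1 mul1r.
  ring.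
apply: primitive_unique => //; first exact: continuous_evol.
move=> y; have [->|y0] := eqVneq y 0; last exact: is_derive_continuous (dW _ y0).
rewrite /continuous_at W0; apply/cvgr0Pnorm_le => e e0.
have e2 : 0 < e / 2 by rewrite divr_gt0.
have c1 := cV 0; rewrite /continuous_at/= flow_t0 primitive0 in c1.
have c2 := cG 0; rewrite /continuous_at/= flow_t0 primitive0 mulr0 in c2.
move/cvgr0Pnorm_le : c1 => /(_ _ e2); move/cvgr0Pnorm_le : c2 => /(_ _ e2).
apply: filter_app2; near=> z => /= h1 h2.
rewrite (le_trans (ler_normB _ _))// [e]splitr lerD// (le_trans _ h1)// (normrM (Num.sg z)).
by rewrite normr_sg ler_piMl// lern1 leq_b1.
Unshelve. all: end_near. Qed.

(** Since primitive (evol s v) is again explicit, both sides are combinations of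
    the datum and of its primitive at the same point; the coefficients agree by
    the cocycle identity of the slope. *)
Lemma evolD t s v : continuous v -> evol (t + s) v = evol t (evol s v).
Proof.
move=> cv; apply/funext => x; have [->|x0] := eqVneq x 0.
  by rewrite !evol_t0.
rewrite [RHS]/evol primitive_evol// addrC /evol -flowD.
rewrite !gain_slope sgr_flow slopeD invfM.
set a := (slope s _)^-1; set b := (slope t x)^-1; set V := primitive v _; ring.
Qed.

Lemma evol_dx_bound t v (M N : R) x : continuous v ->
  (forall z, `|v z| <= M) -> (forall z, z != 0 -> `|derive1 v z| <= N) -> x != 0 ->
  `|evol_dx t v x| <= N * expR `|t| + (expR `|t| - 1) * M * (2 + `|t|)
     + (expR `|t| - 1) * (M * expR `|t|).
Proof.
move=> cv vM vN x0; have M0 : 0 <= M by exact: le_trans (vM 0).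
have [_ e1 _ _] := expR_bounds t; have e0 : 0 <= expR `|t| by exact: expR_ge0.
have sl : `|slope t x| <= expR `|t|.
  by rewrite gtr0_norm ?slope_gt0//; have /andP[] := slope_bounds t x.
have /andP[p0 p1] := peakon_bounds x.
have g1 : `|gain t x| <= expR `|t| - 1.
  by apply: le_trans (gain_bound t x) _; rewrite ler_piMl// subr_ge0.
apply: le_trans (ler_normD _ _) _; apply: lerD.
  apply: le_trans (ler_normB _ _) _; apply: lerD.
    by rewrite (normrM (derive1 v _)) ler_pM// vN// flow_neq0.
  rewrite -mulrA (normrM (Num.sg x)) normr_sg x0 mul1r.
  apply: le_trans (gain_primitive_bound t x cv vM) _.
  apply: ler_piMr; first by rewrite !mulr_ge0 ?subr_ge0// addr_ge0.
  by rewrite -expR0 ler_expR oppr_le0 divr_ge0.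
by rewrite (normrM (gain t x)) ler_pM// (normrM (v _)) ler_pM.
Qed.

Lemma half_C1_evol t v g : continuous v -> half_C1 v g -> half_C1 (evol t v)
  (fun x => g (hflow t x) * (1 - hgain t x)^-1 - hgain t x * primitive v (hflow t x)
     + hgain t x * (v (hflow t x) * (1 - hgain t x)^-1)).
Proof.
move=> cv [dg cg]; split => x x0.
  have h1 := dg _ (hflow_gt0 t x0); have h2 := is_derive_hflow_r t (ltW x0).
  have h3 := is_derive_primitive (hflow t x) cv.
  have h4 := is_derive_hgain_r t x.
  have h : is_derive x 1 ((v \o hflow t) + hgain t * (primitive v \o hflow t))
    (g (hflow t x) * (1 - hgain t x)^-1 - hgain t x * primitive v (hflow t x)
     + hgain t x * (v (hflow t x) * (1 - hgain t x)^-1)).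
    apply: is_derive_eq (is_deriveD (is_derive1_comp h1 h2)
      (is_deriveM h4 (is_derive1_comp h3 h2))) _.
    by rewrite /GRing.scale/=; ring.
  apply: near_eq_is_derive h; apply: filterS (near_pos x0) => y y0.
  by rewrite /evol flow_pos ?ltW// gain_pos.
have cf : {for x, continuous (@hflow R t)}.
  exact: is_derive_continuous (is_derive_hflow_r t x0).
have ch : {for x, continuous (@hgain R t)}.
  exact: is_derive_continuous (is_derive_hgain_r t x).
have cs : {for x, continuous (fun x => (1 - hgain t x)^-1)}.
  apply: continuousV; first by rewrite gt_eqF// hslope_gt0.
  by apply: continuousB => //; exact: cvg_cst.
have comp (f : R -> R) : {for hflow t x, continuous f} ->
    {for x, continuous (fun y => f (hflow t y))}.
  by move=> c; apply: continuous_comp cf c.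
have cg' := comp _ (cg _ (hflow_ge0 t x0)).
have cv' := comp v (cv (hflow t x)).
have cV' := comp (primitive v) (@continuous_primitive R v cv (hflow t x)).
apply: continuousD; last by apply: continuousM => //; exact: continuousM.
by apply: continuousB; exact: continuousM.
Qed.

Lemma C10_evol t v : C10 v -> C10 (evol t v).
Proof.
move=> vC; have cv := C10_continuous vC.
have [M M0 vM] := C10_bounded vC; have [N N0 vN] := C10_derive_bounded vC.
have [g1 vg1] := C10_half vC; have [g2 vg2] := C10_half (C10_reflect vC).
have er : evol t v \o -%R = evol (- t) (v \o -%R).
  by apply/funext => x /=; rewrite evolN.
apply: (C10_intro (@continuous_evol R t v cv) _ (half_C1_evol t cv vg1)).
- move=> x; apply: le_trans (ler_normD _ _) _.
  apply: (lerD (vM _)); apply: le_trans (gain_primitive_bound t x cv vM) _.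
  have [_ e1 _ _] := expR_bounds t.
  apply: ler_piMr; first by rewrite !mulr_ge0 ?subr_ge0// addr_ge0.
  by rewrite -expR0 ler_expR oppr_le0 divr_ge0.
- by rewrite er; apply: half_C1_evol vg2; exact: continuous_reflect.
- move=> x x0; rewrite (is_derive_derive1 (is_derive_evol_x t vC x0)).
  exact: (evol_dx_bound t cv vM vN x0).
Qed.

Lemma is_derive_gain_t0 x : x != 0 -> is_derive (0 : R) 1 (gain ^~ x) (peakon x).
Proof.
move=> x0; have h := is_derive_hgain_t (Num.sg x * 0) `|x|.
have -> : gain ^~ x = fun t => Num.sg x * ((hgain ^~ `|x|) \o (fun t => Num.sg x * t)) t.
  by [].
apply: is_derive_eq; rewrite /GRing.scale/= mulr0 oppr0 expR0.
transitivity (Num.sg x * Num.sg x * peakon x); first by rewrite /peakon; ring.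
by rewrite sgr_sqr// mul1r.
Qed.

Lemma is_derive_evol_t0 v x : C10 v -> is_derive (0 : R) 1 (fun t => evol t v x) (opA v x).
Proof.
move=> vC; have cv := C10_continuous vC; have [->|x0] := eqVneq x 0.
  rewrite /opA peakon0 subrr mul0r mul1r primitive0 addr0.
  rewrite (_ : (fun t => _) = cst (v 0)); first exact: is_derive_cst.
  by apply/funext => t; rewrite evol_t0.
have h1 := C10_is_derive vC x0; rewrite -{1}[x](flow_0x) in h1.
have h2 := is_derive_flow_t 0 x; rewrite flow_0x in h2.
have h3 := is_derive_primitive (flow 0 x) cv; rewrite {2}flow_0x in h3.
have h4 := is_derive_gain_t0 x0.
have -> : (fun t => evol t v x) =
    (v \o (flow ^~ x)) + (gain ^~ x) * (primitive v \o (flow ^~ x)) by [].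
apply: is_derive_eq (is_deriveD (@is_derive1_comp _ v (flow ^~ x) _ _ _ h1 h2)
  (is_deriveM h4 (@is_derive1_comp _ (primitive v) (flow ^~ x) _ _ _ h3 h2))) _.
rewrite /GRing.scale/= /opA flow_0x.
rewrite (_ : gain 0 x = 0); last by rewrite /gain mulr0 /hgain oppr0 expR0 subrr !mulr0.
ring.
Qed.

(** The group property reduces the claim to time 0, where the gain vanishes and
    grows at the rate peakon x. *)
Lemma is_derive_evol_t t v x : C10 v ->
  is_derive t 1 (fun s => evol s v x) (opA (evol t v) x).
Proof.
move=> vC; have h := is_derive_evol_t0 x (C10_evol t vC).
have -> : (fun s => evol s v x) = (fun h => evol h (evol t v) x) \o (fun s => s - t).
  by apply/funext => s /=; rewrite -evolD ?subrK//; exact: C10_continuous.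
have h' : is_derive (t - t) 1 (fun h => evol h (evol t v) x) (opA (evol t v) x).
  by rewrite subrr.
by apply: is_derive_eq; rewrite subr0 mulr1.
Qed.

End EvolutionGroup.

(** * Local integrability and the fundamental theorem of calculus *)

Section LocalIntegrability.
Context {R : realType}.
Notation mu := (@lebesgue_measure R).
Implicit Types (f g h v : R -> R).

Lemma measurable_off0 (f : R -> R) : (forall x, x != 0 -> {for x, continuous f}) ->
  measurable_fun setT f.
Proof.
move=> cf; rewrite (_ : [set: R] = [set x | x != 0] `|` [set 0]); last first.
  by apply/seteqP; split => // x _ /=; case: eqVneq; [right|left].
have mneq : measurable [set x : R | x != 0].
  by apply: open_measurable; exact: open_neq.
apply/measurable_funU => //; split; last exact: measurable_fun_set1.
apply: open_continuous_measurable_fun; first exact: open_neq.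
by move=> x; rewrite inE/=; exact: cf.
Qed.

Lemma measurable_derive1 v : C10 v -> measurable_fun setT (derive1 v).
Proof. by move=> [_ dv _ _]; apply: measurable_off0 => x /dv[]. Qed.
(** On a set of finite measure, constants and squares of L2 functions are
    integrable. *)
Lemma integrable_growth f g (C : R) (A : set R) : measurable A ->
  (mu A < +oo)%E -> measurable_fun setT f -> L2 g ->
  (forall x, `|f x| <= C + g x ^+ 2) -> mu.-integrable A (EFin \o f).
Proof.
move=> mA fA mf /L2P[mg lg] fg; apply/integrableP; split.
  by apply: measurable_funTS; exact/measurable_EFinP.
have C0 : 0 <= `|C| by [].
apply: (@le_lt_trans _ _ (\int[mu]_(x in A) (`|C|%:E + (g x ^+ 2)%:E))%E).
  apply: ge0_le_integral => //.
  - by apply: measurable_funTS; apply/measurable_EFinP; exact: measurableT_comp.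
  - apply: measurable_funTS; apply: emeasurable_funD => //.
    exact: measurable_sqr.
  - move=> x _; rewrite /= -EFinD lee_fin (le_trans (fg x))// lerD2r.
    exact: ler_norm.
rewrite ge0_integralD//; last 2 first.
  - by move=> x _; rewrite lee_fin sqr_ge0.
  - by apply: measurable_funTS; exact: measurable_sqr.
rewrite integral_cst//; apply: lte_add_pinfty; first by rewrite lte_mul_pinfty.
apply: le_lt_trans lg; apply: ge0_subset_integral => //.
  exact: measurable_sqr.
by move=> x _; rewrite lee_fin sqr_ge0.
Qed.

Lemma L2_cst0 : L2 (cst 0 : R -> R).
Proof.
apply/L2P; split => //; rewrite /sqint.
by under eq_integral do rewrite /= expr0n/=; rewrite integral0.
Qed.

Lemma integrable_bounded_itv f (a b C : R) : measurable_fun setT f ->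
  (forall x, `|f x| <= C) -> mu.-integrable `[a, b] (EFin \o f).
Proof.
move=> mf fC; apply: (@integrable_growth _ (cst 0) C) => //.
- by rewrite /= lebesgue_measure_itv/=; case: ifPn; rewrite -?EFinD ltry.
- exact: L2_cst0.
- by move=> x; rewrite expr0n/= addr0.
Qed.

Lemma patch_support f (A : set R) : (forall x, ~ A x -> f x = 0) -> f \_ A = f.
Proof.
move=> fA; apply/funext => x; rewrite patchE; case: ifPn => // xA.
by rewrite fA// => Ax; move: xA; rewrite mem_set.
Qed.

Lemma Rintegral_support f (A : set R) : (forall x, ~ A x -> f x = 0) ->
  \int[mu]_x f x = \int[mu]_(x in A) f x.
Proof. by move=> fA; rewrite [RHS]Rintegral_mkcond patch_support. Qed.

(** The integrand h need not be continuous up to the end points; it is compared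
    with the continuous f, the end points being negligible. This is what makes
    the formula usable up to a corner. *)
Lemma FTC_itv F f h (a b : R) : a < b -> continuous F ->
  (forall x, a <= x <= b -> {for x, continuous f}) ->
  (forall x, a < x < b -> is_derive x 1 F (f x)) ->
  measurable_fun setT h -> (forall x, a < x < b -> h x = f x) ->
  \int[mu]_(x in `[a, b]) h x = F b - F a.
Proof.
move=> ab cF cf dF mh hf.
have cfw : {within `[a, b], continuous f}.
  apply: continuous_in_subspaceT => x; rewrite inE/= in_itv/=; exact: cf.
have inner x : x \in `]a, b[%classic -> a < x < b by rewrite inE/= in_itv.
have mf : measurable_fun `]a, b[ (EFin \o f).
  apply/measurable_EFinP; apply: (@eq_measurable_fun _ _ _ _ _ h).
    by move=> x /inner; exact: hf.
  exact: measurable_funTS.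
have mh' : measurable_fun `]a, b[ (EFin \o h).
  by apply: measurable_funTS; exact/measurable_EFinP.
have -> : \int[mu]_(x in `[a, b]) h x = \int[mu]_(x in `[a, b]) f x.
  rewrite /Rintegral; congr fine.
  rewrite (integral_itv_bndoo _ _ mh') (integral_itv_bndoo _ _ mf).
  by apply: eq_integral => x /inner /hf /= ->.
rewrite /Rintegral (@continuous_FTC2 R f F a b ab cfw)//.
- split.
  + by move=> x; rewrite in_itv/= => /dF[].
  + apply: cvg_at_right_filter; exact: cF.
  + apply: cvg_at_left_filter; exact: cF.
- by move=> x; rewrite in_itv/= => /dF /is_derive_derive1.
Qed.

End LocalIntegrability.

(** * Integration by parts against test functions *)

Section WeakDerivative.
Context {R : realType}.
Notation mu := (@lebesgue_measure R).
Implicit Types (f g h v psi : R -> R).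

Lemma test_support psi : test_C1c psi ->
  exists2 K, 0 < K & forall x, K <= `|x| -> psi x = 0 /\ derive1 psi x = 0.
Proof.
move=> [dpsi _ /compact_bounded[M [_ hM]]].
pose K := `|M| + 1; have MK : M < K by rewrite /K; have := ler_norm M; lra.
have psi0 x : K < `|x| -> psi x = 0.
  move=> Kx; apply/eqP; apply: contraT => px.
  suff : `|x| <= K by rewrite leNgt Kx.
  by apply: hM => //; apply: subset_closure.
have K0 : 0 < K by rewrite /K ltr_wpDl.
(* Beyond K + 1 a whole neighbourhood of x lies off the support, so that the
   derivative vanishes as well. *)
exists (K + 1) => [|x Kx]; first by rewrite addr_gt0.
have Kx' : K < `|x| by apply: lt_le_trans Kx; rewrite ltrDl.
split; first exact: psi0.
apply: is_derive_derive1; apply: (@near_eq_is_derive _ _ _ (cst 0)).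
  have : \forall y \near x, K < `|y|.
    exact: (cvgr_gt _ (@norm_continuous _ R x) _ Kx').
  by apply: filterS => y /psi0 ->.
Qed.

Lemma test_bounded psi : test_C1c psi ->
  exists2 C, 0 <= C & forall x, `|psi x| <= C /\ `|derive1 psi x| <= C.
Proof.
move=> tpsi; have [dpsi cpsi _] := tpsi; have [K K0 hK] := test_support tpsi.
have cont : continuous psi.
  move=> x; apply: differentiable_continuous; exact/derivable1_diffP.
have bnd f : continuous f -> (forall x, K <= `|x| -> f x = 0) ->
    exists2 C, 0 <= C & forall x, `|f x| <= C.
  move=> cf f0.
  have /compact_bounded[M [_ hM]] : compact (f @` `[- K, K]).
    apply: continuous_compact; last exact: segment_compact.
    exact: continuous_subspaceT.
  exists (`|M| + 1) => [|x]; first by rewrite addr_ge0.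
  have [Kx|Kx] := leP K `|x|; first by rewrite f0// normr0 addr_ge0.
  apply: hM; first by have := ler_norm M; lra.
  by exists x => //=; rewrite in_itv/= -ler_norml ltW.
have [A A0 hA] := bnd _ cont (fun x Kx => (hK x Kx).1).
have [B B0 hB] := bnd _ cpsi (fun x Kx => (hK x Kx).2).
exists (A + B) => [|x]; first by rewrite addr_ge0.
by split; [rewrite (le_trans (hA x))// lerDl|rewrite (le_trans (hB x))// lerDr].
Qed.

(** Integration by parts on each half-line; the two boundary terms at the corner
    cancel because v is continuous there. *)
Lemma C10_weak_derivative v : C10 v -> weak_derivative v (derive1 v).
Proof.
move=> vC psi tpsi; have [dpsi cpsi _] := tpsi.
have [K K0 hK] := test_support tpsi; have [C C0 hC] := test_bounded tpsi.
have [M M0 vM] := C10_bounded vC; have cv := C10_continuous vC.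
have contpsi : continuous psi.
  move=> x; apply: differentiable_continuous; exact/derivable1_diffP.
have mv : measurable_fun setT v by exact: continuous_measurable_fun.
have mdv := measurable_derive1 vC.
have mpsi : measurable_fun setT psi by exact: continuous_measurable_fun.
have mdpsi : measurable_fun setT (derive1 psi) by exact: continuous_measurable_fun.
have [N N0 vN] : exists2 N, 0 <= N & forall x, `|derive1 v x| <= N.
  have [N N0 vN] := C10_derive_bounded vC.
  exists (N + `|derive1 v 0|) => [|x]; first by rewrite addr_ge0.
  have [->|x0] := eqVneq x 0; first by rewrite lerDr.
  by rewrite (le_trans (vN _ x0))// lerDl.
have iD (A : R -> R) (a b : R) (B : R) : measurable_fun setT A ->
    (forall x, `|A x| <= B) -> mu.-integrable `[a, b] (EFin \o A).
  by move=> mA hA; exact: integrable_bounded_itv hA.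
pose f1 x := v x * derive1 psi x; pose f2 x := derive1 v x * psi x.
have mf1 : measurable_fun setT f1 by exact: measurable_funM.
have mf2 : measurable_fun setT f2 by exact: measurable_funM.
have b1 x : `|f1 x| <= M * C by rewrite (normrM (v x)) ler_pM// (hC x).2.
have b2 x : `|f2 x| <= N * C by rewrite (normrM (derive1 v x)) ler_pM// (hC x).1.
have out (x : R) : ~ `[- K, K]%classic x -> K <= `|x|.
  move=> h; rewrite leNgt; apply/negP => xK; apply: h => /=.
  by rewrite in_itv/= -ler_norml ltW.
rewrite (@Rintegral_support _ f1 `[- K, K]); last first.
  by move=> x /out /hK[_ h]; rewrite /f1 h mulr0.
rewrite (@Rintegral_support _ f2 `[- K, K]); last first.
  by move=> x /out /hK[h _]; rewrite /f2 h mulr0.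
apply/eqP; rewrite -addr_eq0 -RintegralD//; last 2 first.
- exact: iD b1.
- exact: iD b2.
have psiK : psi K = 0 by apply: (hK K _).1; exact: ler_norm.
have psiNK : psi (- K) = 0 by apply: (hK (- K) _).1; rewrite normrN ler_norm.
pose h x := f1 x + f2 x.
have mh : measurable_fun setT h by exact: measurable_funD.
have bh x : `|h x| <= M * C + N * C.
  by rewrite (le_trans (ler_normD _ _))// lerD.
have cG : continuous (v * psi) by move=> x; apply: continuousM; [exact: cv|exact: contpsi].
have dG (x : R) : x != 0 -> is_derive x 1 (v * psi) (h x).
  move=> x0; have h1 := C10_is_derive vC x0; have h2 := derive1_is_derive (dpsi x).
  by apply: is_derive_eq; rewrite /GRing.scale/= /h /f1 /f2; ring.
have [g1 vg1] := C10_half vC; have [g2 vg2] := C10_half (C10_reflect vC).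
have I1 : \int[mu]_(x in `[0, K]) h x = (v * psi) K - (v * psi) 0.
  apply: (@FTC_itv _ _ (fun x => v x * derive1 psi x + g1 x * psi x)) => //.
  - move=> x /andP[x0 _]; apply: continuousD.
      by apply: continuousM; [exact: cv|exact: cpsi].
    by apply: continuousM; [exact: vg1.2|exact: contpsi].
  - move=> x /andP[x0 _]; rewrite -(half_C1_derive1 vg1 x0).
    by apply: dG; rewrite gt_eqF.
  - by move=> x /andP[x0 _]; rewrite -(half_C1_derive1 vg1 x0).
have I2 : \int[mu]_(x in `[- K, 0]) h x = (v * psi) 0 - (v * psi) (- K).
  have g2E x : x < 0 -> derive1 v x = - g2 (- x).
    move=> x0; have nx : 0 < - x by rewrite oppr_gt0.
    rewrite -(half_C1_derive1 vg2 nx).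
    have d : derivable v (- - x) 1.
      have xn0 : x != 0 by rewrite lt_eqF.
      by rewrite opprK; have [] := C10_is_derive vC xn0.
    by rewrite (is_derive_derive1 (derive1_reflect d)) opprK opprK.
  apply: (@FTC_itv _ _ (fun x => v x * derive1 psi x + (- g2 (- x)) * psi x)) => //.
  - by rewrite oppr_lt0.
  - move=> x /andP[_ x0]; apply: continuousD.
      by apply: continuousM; [exact: cv|exact: cpsi].
    apply: continuousM; last exact: contpsi.
    apply: continuousN; apply: (@continuous_comp _ _ _ (-%R) g2).
      exact: opp_continuous.
    by apply: vg2.2; rewrite oppr_ge0.
  - by move=> x /andP[_ x0]; rewrite -g2E//; apply: dG; rewrite lt_eqF.
  - by move=> x /andP[_ x0]; rewrite -g2E.
have ih := iD _ (- K) K _ mh bh.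
have := @Rintegral_itvB R h (BLeft (- K)) (BRight K) 0 ih.
rewrite !bnd_simp oppr_le0 (ltW K0) => /(_ isT isT) /eqP.
rewrite subr_eq => /eqP ->; rewrite Rintegral_itv_obnd_cbnd; last first.
  apply: integrableS ih => //; apply: subset_itvr; rewrite bnd_simp.
  by rewrite oppr_le0 ltW.
rewrite I1 I2; apply/eqP; rewrite !fctE psiK psiNK; ring.
Qed.

End WeakDerivative.

(** * Uniqueness of the weak derivative *)

Section FundamentalLemma.
Context {R : realType}.
Notation mu := (@lebesgue_measure R).
Implicit Types (f g h v psi : R -> R) (a b : R).

(** Unlike the positive part itself, its square is continuously differentiable. *)
Definition pos_sqr (y : R) : R := Num.max 0 y ^+ 2.

Lemma is_derive_pos_sqr (y : R) : is_derive y 1 pos_sqr (2 * Num.max 0 y).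
Proof.
have [y0|y0|->] := ltgtP y 0.
- rewrite mulr0; apply: (@near_eq_is_derive _ _ _ (cst 0)).
  have : \forall z \near y, z < 0 by exact: lt_nbhsl.
  by apply: filterS => z z0; rewrite /pos_sqr max_l ?ltW// expr0n.
- have h : is_derive y 1 (fun z : R => z ^+ 2) (2 * y).
    by apply: is_derive_eq; rewrite /GRing.scale/=; ring.
  apply: near_eq_is_derive h.
  by apply: filterS (near_pos y0) => z z0; rewrite /pos_sqr max_r ?ltW.
rewrite mulr0; apply/is_derive1_caratheodory.
exists (fun z => Num.max 0 z); split; last by rewrite maxxx.
  move=> z; rewrite /pos_sqr maxxx expr0n/= !subr0.
  by have [z0|z0] := ltP 0 z; rewrite ?mulr0// ?mul0r ?expr0n ?expr2.
apply: (@continuous_max _ _ (cst 0) id); first exact: cvg_cst.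
exact: cvg_id.
Qed.

(** A C^1 approximation from below of the indicator of the interval from a to b:
    it tends to 1 exactly where (x - a) (b - x) is positive. *)
Definition bump a b (n : nat) (x : R) : R :=
  1 - expR (- (n%:R * pos_sqr ((x - a) * (b - x)))).

Lemma is_derive_bump a b (n : nat) (x : R) : is_derive x 1 (bump a b n)
  (expR (- (n%:R * pos_sqr ((x - a) * (b - x)))) *
    (n%:R * (2 * Num.max 0 ((x - a) * (b - x)) * ((b - x) - (x - a))))).
Proof.
have h1 := is_derive_pos_sqr ((x - a) * (b - x)).
pose q : R -> R := (id - cst a) * (cst b - id).
have dq : is_derive x 1 q ((b - x) - (x - a)).
  by apply: is_derive_eq; rewrite /GRing.scale/= !fctE/=; ring.
have -> : bump a b n = cst 1 - (expR \o (- (cst n%:R * (pos_sqr \o q)))).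
  by apply/funext => y.
apply: is_derive_eq.
rewrite /GRing.scale/= !fctE/= /q !fctE/=; ring.
Qed.

Lemma bump_bounds a b n x : 0 <= bump a b n x <= 1.
Proof.
rewrite /bump subr_ge0 -expR0 ler_expR oppr_le0 lerBlDr lerDl expR_ge0 andbT.
by rewrite mulr_ge0// /pos_sqr sqr_ge0.
Qed.

Lemma bump_out a b n x : a <= b -> ~~ (a < x < b) -> bump a b n x = 0.
Proof.
move=> ab; rewrite negb_and -!leNgt => xab.
rewrite /bump /pos_sqr max_l ?expr0n ?mulr0 ?oppr0 ?expR0 ?subrr//.
by case/orP: xab => h; nra.
Qed.

Lemma bump_cvg a b (x : R) : a < x < b -> bump a b n x @[n --> \oo] --> (1 : R).
Proof.
move=> /andP[ax xb].
have q0 : 0 < pos_sqr ((x - a) * (b - x)).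
  by rewrite /pos_sqr exprn_gt0// lt_max mulr_gt0 ?orbT// subr_gt0.
set q := pos_sqr _ in q0.
rewrite /bump -/q -[X in _ --> X]subr0; apply: cvgB; first exact: cvg_cst.
have h : expR (- q) ^+ n @[n --> \oo] --> (0 : R).
  by apply: cvg_expr; rewrite ger0_norm ?expR_ge0// -expR0 ltr_expR oppr_lt0.
apply: near_cvg h; near=> n.
by rewrite -mulrN mulrC expRM_natr.
Unshelve. all: end_near. Qed.

Lemma bump_test a b n : a <= b -> test_C1c (bump a b n).
Proof.
move=> ab; split.
- by move=> x; have [] := is_derive_bump a b n x.
- have -> : derive1 (bump a b n) = fun x =>
    expR (- (n%:R * pos_sqr ((x - a) * (b - x)))) *
    (n%:R * (2 * Num.max 0 ((x - a) * (b - x)) * ((b - x) - (x - a)))).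
    by apply/funext => x; exact: is_derive_derive1 (is_derive_bump a b n x).
  have cq : continuous (fun x : R => (x - a) * (b - x)).
    by move=> x; apply: cvgM; apply: cvgB; (exact: cvg_cst || exact: cvg_id).
  have cm : continuous (fun x : R => Num.max 0 ((x - a) * (b - x))).
    move=> x; apply: (@continuous_max _ _ (cst 0) (fun x => (x - a) * (b - x))).
      exact: cvg_cst.
    exact: cq.
  move=> x; apply: cvgM.
    apply: (@continuous_comp _ _ _ (fun x => - (n%:R * pos_sqr ((x - a) * (b - x)))) expR);
      last exact: continuous_expR.
    apply: cvgN; apply: cvgMl_tmp.
    apply: (@continuous_comp _ _ _ (fun x : R => (x - a) * (b - x)) pos_sqr).
      exact: cq.
    exact: is_derive_continuous (is_derive_pos_sqr _).
  apply: cvgMl_tmp; apply: cvgM; first by apply: cvgMl_tmp; exact: cm.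
  by apply: cvgB; apply: cvgB; (exact: cvg_cst || exact: cvg_id).
- apply: (@subclosed_compact _ _ `[a, b]); first exact: closed_closure.
    exact: segment_compact.
  rewrite closureE => x; apply; split; first exact: itv_closed.
  move=> y /= by0; rewrite in_itv/=; apply: contraT => yab.
  move: by0; rewrite (bump_out n ab) ?eqxx//.
  by apply: contra yab => /andP[/ltW -> /ltW ->].
Qed.

(** The fundamental lemma of the calculus of variations: the test functions
    separate points, first on intervals, then almost everywhere by Lebesgue's
    differentiation theorem. *)
Lemma ae_eq0_of_test (d : R -> R) g (C : R) : measurable_fun setT d -> L2 g ->
  (forall x, `|d x| <= C + g x ^+ 2) ->
  (forall psi, test_C1c psi -> \int[mu]_x (d x * psi x) = 0) ->
  {ae mu, forall x, d x = 0}.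
Proof.
move=> md lg dg dpsi.
have itv_fin a b : (mu `[a, b] < +oo)%E.
  by rewrite lebesgue_measure_itv/=; case: ifPn; rewrite -?EFinD ltry.
have iab a b : mu.-integrable `[a, b] (EFin \o d).
  exact: integrable_growth dg.
have oo0 a b : a < b -> (\int[mu]_(x in `]a, b[) (d x)%:E)%E = 0%E.
  move=> ab.
  have mdb n : measurable_fun setT (fun x => d x * bump a b n x).
    apply: measurable_funM => //; apply: continuous_measurable_fun => x.
    exact: is_derive_continuous (is_derive_bump a b n x).
  have sub : `]a, b[ `<=` `[a, b] by exact: subset_itv_oo_cc.
  have id : mu.-integrable `]a, b[ (EFin \o d) by exact: integrableS (iab a b).
  have db_le n x : `|d x * bump a b n x| <= `|d x|.
    have /andP[b0 b1] := bump_bounds a b n x.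
    by rewrite (normrM (d x)) ler_piMr// ger0_norm.
  have idb n : mu.-integrable `]a, b[ (EFin \o (fun x => d x * bump a b n x)).
    apply: le_integrable id => //.
      by apply: measurable_funTS; apply/measurable_EFinP; exact: mdb.
    by move=> x _; rewrite lee_fin; exact: db_le.
  have int0 n : (\int[mu]_(x in `]a, b[) (d x * bump a b n x)%:E)%E = 0%E.
    have := dpsi _ (bump_test n (ltW ab)).
    rewrite (@Rintegral_support _ _ `]a, b[); last first.
      move=> x /= xab; rewrite (bump_out n (ltW ab)) ?mulr0//.
      by apply/negP => h; apply: xab; rewrite in_itv.
    rewrite /Rintegral => h.
    have /fineK <- : (\int[mu]_(x in `]a, b[) (d x * bump a b n x)%:E)%E \is a fin_num.
      by apply: integrable_fin_num (idb n).
    by rewrite /= h.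
  have mE (f : R -> R) : measurable_fun setT f ->
      measurable_fun (`]a, b[%classic : set R) (EFin \o f).
    by move=> mf; apply: measurable_funTS; exact/measurable_EFinP.
  have cvgd : {ae mu, forall x, `]a, b[%classic x ->
      (d x * bump a b n x)%:E @[n --> \oo] --> (d x)%:E}.
    apply: aeW => x /=; rewrite in_itv/= => xab; apply: cvg_EFin; first by near=> n.
    by rewrite -[X in _ --> X]mulr1; apply: cvgMl_tmp; exact: bump_cvg.
  have domd : {ae mu, forall x n, `]a, b[%classic x ->
      (`|(d x * bump a b n x)%:E| <= `|d x|%:E)%E}.
    by apply: aeW => x n _; rewrite lee_fin; exact: db_le.
  have := @dominated_convergence _ _ _ mu (`]a, b[%classic : set R) _
    (fun n x => (d x * bump a b n x)%:E) (EFin \o d) (fun x => `|d x|%:E).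
  case => //; [by move=> n; exact: mE|exact: mE|exact: integrable_abse id|].
  move=> _ _ h.
  move: h; rewrite (_ : [sequence _]_n = cst 0%E); last first.
    by apply/funext => n /=; exact: int0.
  by move=> /(cvg_unique _ (cvg_cst _)) => <-.
have cc0 a b : a <= b -> \int[mu]_(x in `[a, b]) d x = 0.
  rewrite le_eqVlt => /predU1P[->|ab].
    by rewrite set_itv1 Rintegral_set1.
  rewrite /Rintegral integral_itv_bndoo ?oo0//.
  by apply: measurable_funTS; exact/measurable_EFinP.
have locd : locally_integrable setT d.
  split => // [|K _ cK]; first exact: openT.
  have /integrableP[_] : mu.-integrable K (EFin \o d).
    apply: integrable_growth dg => //; first exact: compact_measurable.
    exact: compact_finite_measure.
  by [].
(* At almost every x, the value d x is the derivative of the integral from a to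
   x, which is identically 0. *)
have half a : {ae mu, forall x, a < x -> d x = 0}.
  have := FTC1 (a := BLeft a) (iab a) locd.
  apply: ae_mono => x h ax; have {h} [_ <-] : derivable _ x 1 /\ _ := h ax.
  apply: is_derive_derive1; apply: (@near_eq_is_derive _ _ _ (cst 0)).
  by apply: filterS (lt_nbhsr ax) => y ay; rewrite cc0// ltW.
rewrite /almost_everywhere.
have := @negligible_bigcup _ _ _ mu (fun n => ~` [set x | - n%:R < x -> d x = 0])
  (fun n => half (- n%:R)).
apply: negligibleS => x /= dx0.
exists (Num.bound `|x|) => //= h; apply: dx0; apply: h.
have := archi_boundP (normr_ge0 x); have := ler_norm (- x); rewrite normrN; lra.
Unshelve. all: end_near. Qed.

(** Both g and the classical derivative are weak derivatives, so that their
    difference annihilates all test functions. *)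
Lemma weak_derivative_ae v g : C10 v -> L2 g -> weak_derivative v g ->
  {ae mu, forall x, g x = derive1 v x}.
Proof.
move=> vC lg vg; have /L2P[mg _] := lg; have mdv := measurable_derive1 vC.
have [N N0 vN] := C10_derive_bounded vC.
pose N' := N + `|derive1 v 0|.
have vN' x : `|derive1 v x| <= N'.
  have [->|x0] := eqVneq x 0; first by rewrite lerDr.
  by rewrite (le_trans (vN _ x0))// lerDl.
have dg x : `|g x - derive1 v x| <= N' + 1 + g x ^+ 2.
  apply: le_trans (ler_normB _ _) _; have := vN' x.
  have : `|g x| <= 1 + g x ^+ 2.
    rewrite -real_normK ?num_real//; have := normr_ge0 (g x); nra.
  lra.
have : {ae mu, forall x, g x - derive1 v x = 0}.
  apply: (@ae_eq0_of_test _ g (N' + 1)) => //; first exact: measurable_funB.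
  move=> psi tpsi; have [dpsi _ _] := tpsi.
  have [K K0 hK] := test_support tpsi; have [C C0 hC] := test_bounded tpsi.
  have mpsi : measurable_fun setT psi.
    apply: continuous_measurable_fun => x; apply: differentiable_continuous.
    exact/derivable1_diffP.
  have out f (x : R) : ~ `[- K, K]%classic x -> f x * psi x = 0.
    move=> h; rewrite (hK x _).1 ?mulr0// leNgt; apply/negP => xK; apply: h => /=.
    by rewrite in_itv/= -ler_norml ltW.
  have eqint : \int[mu]_x (g x * psi x) = \int[mu]_x (derive1 v x * psi x).
    by apply: oppr_inj; rewrite -vg// -C10_weak_derivative.
  move: eqint; rewrite (Rintegral_support (out g)) (Rintegral_support (out (derive1 v))).
  rewrite (Rintegral_support (out (fun x => g x - derive1 v x))) => eqint.
  have fin : (mu `[(- K)%R, K] < +oo)%E.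
    by rewrite lebesgue_measure_itv/=; case: ifPn; rewrite -?EFinD ltry.
  have i1 : mu.-integrable `[- K, K] (EFin \o (fun x => g x * psi x)).
    apply: (@integrable_growth _ _ (fun x => C * g x) (C ^+ 2 + 1)) => //.
    - exact: measurable_funM.
    - exact: L2Z.
    - move=> x; rewrite (normrM (g x)) exprMn -(real_normK (num_real (g x))).
      have h1 := ler_wpM2l (normr_ge0 (g x)) (hC x).1.
      have h2 := sqr_ge0 (C * `|g x| - 1); have h3 := sqr_ge0 C.
      have h4 : 0 <= C * `|g x| by rewrite mulr_ge0.
      nra.
  have i2 : mu.-integrable `[- K, K] (EFin \o (fun x => derive1 v x * psi x)).
    apply: (@integrable_bounded_itv _ _ _ _ (N' * C)); first exact: measurable_funM.
    by move=> x; rewrite (normrM (derive1 v x)) ler_pM// (hC x).1.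
  under eq_Rintegral do rewrite mulrBl.
  by rewrite RintegralB// eqint subrr.
by apply: ae_mono => x /subr0_eq.
Qed.

(** For such functions membership in H1 and, below, the H1 norm are read off the
    classical derivative. *)
Lemma C10_H1P v : C10 v -> H1 v <-> L2 v /\ L2 (derive1 v).
Proof.
move=> vC; split => [[lv [g lg vg]]|[lv lv']]; last first.
  by split => //; exists (derive1 v) => //; exact: C10_weak_derivative.
split => //; apply/L2P; have mdv := measurable_derive1 vC; split => //.
have /L2P[mg] := lg.
by rewrite (ae_eq_sqint mg mdv (weak_derivative_ae vC lg vg)).
Qed.

Lemma C10_H1norm v : C10 v -> H1 v ->
  H1norm v = ((sqint v + sqint (derive1 v)) `^ 2^-1)%E.
Proof.
move=> vC vH; have [lv lv'] := (C10_H1P vC).1 vH.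
have [lw vw] : L2 (wderiv v) /\ weak_derivative v (wderiv v).
  rewrite /wderiv; case: xgetP => [g _ //|/(_ (derive1 v))]; case.
  by split => //; exact: C10_weak_derivative.
rewrite /H1norm !L2norm_sqr; congr ((_ + _) `^ _)%E.
have /L2P[mw _] := lw; apply: ae_eq_sqint => //; first exact: measurable_derive1.
exact: weak_derivative_ae.
Qed.

End FundamentalLemma.

(** * Square integrability of the evolution *)

Section EvolutionL2.
Context {R : realType}.
Notation mu := (@lebesgue_measure R).
Implicit Types (v : R -> R) (t s h x : R).

Lemma measurable_gain t : measurable_fun setT (gain t : R -> R).
Proof.
apply: measurable_off0 => x x0; exact: is_derive_continuous (is_derive_gain_x t x0).
Qed.

Lemma measurable_sgr : measurable_fun setT (@Num.sg R).
Proof.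
apply: measurable_off0 => x x0.
apply: near_cvg (near_sgr x0) _; exact: cvg_cst.
Qed.

Lemma measurable_slope t : measurable_fun setT (slope t : R -> R).
Proof.
apply: measurable_off0 => x x0.
have h : {for x, continuous (fun y => (1 - Num.sg x * gain t y)^-1)}.
  apply: continuousV; first by rewrite -slopeE invr_eq0 gt_eqF// slope_gt0.
  apply: continuousB; first exact: cvg_cst.
  apply: continuousM; first exact: cvg_cst.
  exact: is_derive_continuous (is_derive_gain_x t x0).
apply: near_cvg h.
by apply: filterS (near_sgr x0) => y yx; rewrite /slope yx.
Qed.

Lemma continuous_measurable v : continuous v -> measurable_fun setT v.
Proof. exact: continuous_measurable_fun. Qed.

(** The square root of peakon, as a square-integrable weight that dominates the
    nonlocal terms. *)
Definition decay x : R := expR (- (`|x| / 2)).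

Lemma continuous_decay : continuous decay.
Proof.
move=> x; apply: (@continuous_comp _ _ _ (fun x : R => - (`|x| / 2)) expR); last exact: continuous_expR.
by apply: cvgN; apply: cvgMr_tmp; exact: norm_continuous.
Qed.

Lemma decay_ge0 x : 0 <= decay x. Proof. exact: expR_ge0. Qed.

(** Its square is peakon, which has an elementary primitive on the half-line. *)
Lemma L2_decay : L2 decay.
Proof.
apply/L2P; split; first by apply: continuous_measurable; exact: continuous_decay.
rewrite /sqint; under eq_integral.
  move=> x _; rewrite (_ : decay x ^+ 2 = peakon x); last first.
    by rewrite /decay /peakon expr2 -expRD; congr expR; field.
  over.
rewrite ge0_symfun_integralT//; last 3 first.
- by move=> x; exact: expR_ge0.
- exact: continuous_peakon.
- by move=> x /=; rewrite peakonN.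
rewrite (_ : [set x | 0 <= x] = `[0, +oo[%classic); last first.
  by apply/seteqP; split => x /=; rewrite in_itv/= andbT.
rewrite (@ge0_continuous_FTC2y R (@peakon R) (fun x => - expR (- x)) 0 0).
- by rewrite oppr0 expR0 -EFinB -EFinM ltry.
- by move=> x _; exact: expR_ge0.
- by apply: continuous_subspaceT; exact: continuous_peakon.
- by rewrite -oppr0; apply: cvgN; exact: cvgr_expR.
- move=> x x0; have h : is_derive x 1 (fun x : R => - expR (- x)) (expR (- x)).
    by apply: is_derive_eq; rewrite mulrN1 opprK.
  by case: h.
- apply: cvg_at_right_filter; apply: cvgN.
  by apply: (@continuous_comp _ _ _ (-%R) expR); [exact: opp_continuous|exact: continuous_expR].
- move=> x; rewrite in_itv/= andbT => x0.
  have h : is_derive x 1 (fun x : R => - expR (- x)) (expR (- x)).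
    by apply: is_derive_eq; rewrite mulrN1 opprK.
  by rewrite (is_derive_derive1 h) /peakon gtr0_norm.
Qed.

(** The nonlocal part of the evolution. *)
Definition drift t v x : R := gain t x * primitive v (flow t x).

Lemma measurable_comp_flow t v : measurable_fun setT v -> measurable_fun setT (v \o flow t).
Proof. by move=> mv; apply: measurableT_comp => //; exact: measurable_flow. Qed.

Lemma measurable_drift t v : continuous v -> measurable_fun setT (drift t v).
Proof.
move=> cv; apply: measurable_funM; first exact: measurable_gain.
apply: measurable_comp_flow; apply: continuous_measurable; exact: continuous_primitive.
Qed.

Lemma sqint_le_decay (f : R -> R) (c : R) : measurable_fun setT f -> 0 <= c ->
  (forall x, `|f x| <= c * decay x) -> (sqint f <= (c ^+ 2 * fine (sqint decay))%:E)%E.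
Proof.
move=> mf c0 fc; have /L2P[md ld] := L2_decay.
rewrite EFinM fineK; last by rewrite ge0_fin_numE// sqint_ge0.
rewrite -sqintZ//; apply: le_sqint => //; first exact: measurable_funM.
by move=> x; apply: le_trans (fc x) _; exact: ler_norm.
Qed.

Lemma drift_bound v (M : R) t x : continuous v -> (forall z, `|v z| <= M) ->
  `|drift t v x| <= (expR `|t| - 1) * M * (2 + `|t|) * decay x.
Proof. exact: gain_primitive_bound. Qed.

Lemma drift_coef_ge0 (M : R) t : 0 <= M -> 0 <= (expR `|t| - 1) * M * (2 + `|t|).
Proof.
move=> M0; have [_ e1 _ _] := expR_bounds t.
by rewrite !mulr_ge0 ?subr_ge0// addr_ge0.
Qed.

Lemma L2_drift t v : C10 v -> L2 (drift t v).
Proof.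
move=> vC; have cv := C10_continuous vC; have [M M0 vM] := C10_bounded vC.
apply: (@le_L2 _ _ (fun x => ((expR `|t| - 1) * M * (2 + `|t|)) * decay x)).
- exact: measurable_drift.
- by apply: L2Z; exact: L2_decay.
- by move=> x; apply: le_trans (drift_bound t x cv vM) _; exact: ler_norm.
Qed.

Lemma L2_evol t v : C10 v -> L2 v -> L2 (evol t v).
Proof. by move=> vC lv; apply: L2D (L2_flow t lv) (L2_drift t vC). Qed.

Lemma L2_slope t (f : R -> R) : L2 f -> L2 (fun x => f (flow t x) * slope t x).
Proof.
move=> lf; have /L2P[mf _] := lf.
apply: (@le_L2 _ _ (fun x => expR `|t| * f (flow t x))).
- by apply: measurable_funM; [exact: measurable_comp_flow|exact: measurable_slope].
- by apply: L2Z; exact: L2_flow.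
- move=> x; rewrite (normrM (f _)) (normrM (expR _)) mulrC ler_wpM2r//.
  rewrite (gtr0_norm (slope_gt0 t x)) (ger0_norm (expR_ge0 _)).
  by have /andP[] := slope_bounds t x.
Qed.

Lemma L2_gain t (f : R -> R) : L2 f -> L2 (fun x => gain t x * (f (flow t x) * slope t x)).
Proof.
move=> lf; have lfs := L2_slope t lf; have /L2P[mfs _] := lfs.
apply: (@le_L2 _ _ (fun x => (expR `|t| - 1) * (f (flow t x) * slope t x))).
- by apply: measurable_funM => //; exact: measurable_gain.
- exact: L2Z.
- move=> x; rewrite (normrM (gain _ _)) (normrM (expR _ - 1)) ler_wpM2r//.
  have /andP[p0 p1] := peakon_bounds x; have [_ e1 _ _] := expR_bounds t.
  rewrite [leRHS]ger0_norm ?subr_ge0// (le_trans (gain_bound t x))//.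
  by rewrite ler_piMl// subr_ge0.
Qed.

Lemma measurable_evol_dx t v : C10 v -> measurable_fun setT (evol_dx t v).
Proof.
move=> vC; have cv := C10_continuous vC; have mdv := measurable_derive1 vC.
apply: measurable_funD.
  apply: measurable_funB.
    by apply: measurable_funM; [exact: measurable_comp_flow|exact: measurable_slope].
  apply: measurable_funM.
    by apply: measurable_funM; [exact: measurable_sgr|exact: measurable_gain].
  apply: measurable_comp_flow; apply: continuous_measurable; exact: continuous_primitive.
apply: measurable_funM; first exact: measurable_gain.
apply: measurable_funM; last exact: measurable_slope.
by apply: measurable_comp_flow; exact: continuous_measurable.
Qed.

Lemma evol_dx_drift t v x : evol_dx t v x = derive1 v (flow t x) * slope t x
  - Num.sg x * drift t v x + gain t x * (v (flow t x) * slope t x).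
Proof. by rewrite /evol_dx /drift; ring. Qed.

Lemma L2_sgr (f : R -> R) : L2 f -> L2 (fun x => Num.sg x * f x).
Proof.
move=> lf; have /L2P[mf _] := lf; apply: le_L2 lf _.
  by apply: measurable_funM => //; exact: measurable_sgr.
by move=> x; rewrite (normrM (Num.sg x)) normr_sg ler_piMl// lern1 leq_b1.
Qed.

Lemma derive1_evol t v x : C10 v -> x != 0 -> derive1 (evol t v) x = evol_dx t v x.
Proof. by move=> vC x0; exact: is_derive_derive1 (is_derive_evol_x t vC x0). Qed.

Lemma H1_evol t v : C10 v -> H1 v -> H1 (evol t v).
Proof.
move=> vC vH; have [lv ldv] := (C10_H1P vC).1 vH; have eC := C10_evol t vC.
apply/(C10_H1P eC); split; first exact: L2_evol.
apply: (@eq_L2 _ _ (evol_dx t v)).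
- exact: measurable_derive1.
- by move=> x x0; exact: derive1_evol.
rewrite (_ : evol_dx t v = ((fun x => derive1 v (flow t x) * slope t x)
  \- (fun x => Num.sg x * drift t v x)) \+ (fun x => gain t x * (v (flow t x) * slope t x))).
  apply: L2D (L2_gain t lv); apply: L2B (L2_slope t ldv) _.
  exact: L2_sgr (L2_drift t vC).
by apply/funext => x; rewrite evol_dx_drift.
Qed.

End EvolutionL2.

(** * Increments along the flow *)

Section DifferenceQuotient.
Context {R : realType}.
Notation mu := (@lebesgue_measure R).
Implicit Types (v : R -> R) (t s h x : R).

(** The local part of the generator. *)
Definition transport v x : R := (1 - peakon x) * derive1 v x.

Lemma continuous_transport v : C10 v -> continuous (transport v).
Proof.
move=> vC x; have [_ dv _ _] := vC; have [N N0 vN] := C10_derive_bounded vC.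
have cp : {for x, continuous (fun y : R => 1 - peakon y)}.
  by apply: cvgB; [exact: cvg_cst|exact: continuous_peakon].
have [x0|x0] := eqVneq x 0; last first.
  by apply: cvgM; [exact: cp|exact: (dv _ x0).2].
rewrite x0 in cp *; rewrite /continuous_at /transport peakon0 subrr mul0r.
rewrite /prop_for /continuous_at peakon0 subrr in cp.
have {}cp : (1 - peakon y) * N @[y --> (0 : R)] --> (0 : R).
  by rewrite -[X in _ --> X](mul0r N); exact: cvgMr_tmp.
apply/cvgr0Pnorm_le => e e0; move/cvgr0Pnorm_le : cp => /(_ _ e0).
apply: filterS => y; apply: le_trans.
have [->|y0] := eqVneq y 0; first by rewrite peakon0 subrr !mul0r.
rewrite (normrM _ (derive1 v y)) (normrM _ N) ler_wpM2l// (le_trans (vN _ y0))//.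
exact: ler_norm.
Qed.

Lemma L2_transport v : C10 v -> L2 (derive1 v) -> L2 (transport v).
Proof.
move=> vC lv; apply: le_L2 lv _; first by apply: continuous_measurable; exact: continuous_transport.
move=> x; have /andP[p0 p1] := peakon_bounds x.
by rewrite /transport (normrM _ (derive1 v x)) ler_piMl// ger0_norm ?subr_ge0// lerBlDr lerDl ltW.
Qed.

(** The corner of v is harmless: no trajectory crosses it, and the trajectory of 0
    is at rest. *)
Lemma is_derive_flow_comp v t x : C10 v ->
  is_derive t 1 (fun s => v (flow s x)) (transport v (flow t x)).
Proof.
move=> vC; have [->|x0] := eqVneq x 0.
  rewrite flow_t0 /transport peakon0 subrr mul0r.
  rewrite (_ : (fun s => _) = cst (v 0)); first exact: is_derive_cst.
  by apply/funext => s; rewrite flow_t0.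
have h1 := C10_is_derive vC (flow_neq0 t x0); have h2 := is_derive_flow_t t x.
have -> : (fun s => v (flow s x)) = v \o flow ^~ x by [].
by apply: is_derive_eq; rewrite mulrC.
Qed.

(** Cauchy-Schwarz on an interval, from the nonnegativity of the variance. *)
Lemma sqr_integral_le (k : R -> R) h : 0 < h -> continuous k ->
  (\int[mu]_(s in `[0, h]) k s) ^+ 2 <= h * \int[mu]_(s in `[0, h]) (k s ^+ 2).
Proof.
move=> h0 ck; set I := \int[mu]_(s in _) k s; set J := \int[mu]_(s in _) _ ^+ 2.
have ck2 : continuous (fun s => k s ^+ 2).
  by move=> s; under eq_fun do rewrite expr2; apply: cvgM; exact: ck.
have mh : fine (mu `[0, h]) = h.
  by rewrite lebesgue_measure_itv/= lte_fin h0 -EFinB subr0.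
(* The mean value of k, around which the variance is taken. *)
pose m := I / h.
have : 0 <= \int[mu]_(s in `[0, h]) (k s - m) ^+ 2.
  by apply: Rintegral_ge0 => s _; exact: sqr_ge0.
have -> : \int[mu]_(s in `[0, h]) (k s - m) ^+ 2 = J - 2 * m * I + m ^+ 2 * h.
  have ic c : mu.-integrable `[0, h] (EFin \o (fun s => c * k s)).
    apply: continuous_itv_integrable => s; apply: cvgMl_tmp; exact: ck.
  rewrite (_ : (fun s => (k s - m) ^+ 2) = (fun s => (k s ^+ 2 - 2 * m * k s) + m ^+ 2)); last first.
    by apply/funext => s; ring.
  rewrite RintegralD//; last 2 first.
  - apply: continuous_itv_integrable => s; apply: cvgB; first exact: ck2.
    apply: cvgMl_tmp; exact: ck.
  - by apply: continuous_itv_integrable => s; exact: cvg_cst.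
  rewrite RintegralB//; last exact: continuous_itv_integrable.
  rewrite RintegralZl//; last exact: continuous_itv_integrable.
  by rewrite Rintegral_cst// mh.
rewrite /m => H.
have hn : h != 0 by rewrite gt_eqF.
have : 0 <= (J - 2 * (I / h) * I + (I / h) ^+ 2 * h) * h by rewrite mulr_ge0// ltW.
have -> : (J - 2 * (I / h) * I + (I / h) ^+ 2 * h) * h = h * J - I ^+ 2 by field.
by rewrite subr_ge0.
Qed.

Lemma measurable_flow2 : measurable_fun setT (fun z : R * R => flow z.2 z.1).
Proof.
have m1 : measurable_fun setT (fun z : R * R => Num.sg z.1).
  by apply: measurableT_comp; [exact: measurable_sgr|exact: measurable_fst].
have m2 : measurable_fun setT (fun z : R * R => expR `|z.1|).
  apply: measurableT_comp; first exact: measurable_expR.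
  by apply: measurableT_comp => //; exact: measurable_fst.
have m3 : measurable_fun setT (fun z : R * R => expR (Num.sg z.1 * z.2)).
  apply: measurableT_comp; first exact: measurable_expR.
  by apply: measurable_funM => //; exact: measurable_snd.
apply: measurable_funM => //; apply: measurableT_comp; first exact: measurable_ln.
by apply: measurable_funD => //; apply: measurable_funM => //; exact: measurable_funB.
Qed.

(** The increment is the time integral of the local part along the flow. By
    Cauchy-Schwarz in time and Tonelli, its square integral is controlled by
    those of the translates, to which the change of variables applies. *)
Lemma sqint_flow_increment_pos v h : C10 v -> 0 < h ->
  (sqint ((v \o flow h) \- v)%R <= (h ^+ 2 * expR h)%:E * sqint (transport v))%E.
Proof.
move=> vC h0; have cv := C10_continuous vC; have cT := continuous_transport vC.
have mT : measurable_fun setT (transport v) by exact: continuous_measurable.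
pose k x s := transport v (flow s x).
have ck x : continuous (k x).
  move=> s; apply: (@continuous_comp _ _ _ (flow ^~ x) (transport v)); last exact: cT.
  exact: is_derive_continuous (is_derive_flow_t s x).
have ck2 x : continuous (fun s => k x s ^+ 2).
  by move=> s; under eq_fun do rewrite expr2; apply: cvgM; exact: ck.
have incr x : v (flow h x) - v x = \int[mu]_(s in `[0, h]) k x s.
  rewrite -[v x]/((fun y => v y) x) -{2}(flow_0x x); apply/esym.
  apply: (@FTC_itv _ (fun s => v (flow s x)) (k x) (k x)) => //.
  - move=> s; exact: is_derive_continuous (is_derive_flow_comp s x vC).
  - by move=> s _; exact: ck.
  - by move=> s _; exact: is_derive_flow_comp.
  - by apply: continuous_measurable; exact: ck.
have mk2 : measurable_fun setT (fun z : R * R => ((k z.1 z.2) ^+ 2)%:E).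
  apply/measurable_EFinP; apply: measurable_funX.
  by apply: measurableT_comp => //; exact: measurable_flow2.
pose J : set R := `[0, h]%classic.
have mJ : measurable J by exact: measurable_itv.
pose K (z : R * R) := (((k z.1 z.2) ^+ 2)%:E * (\1_J z.2)%:E)%E.
have mK : measurable_fun setT K.
  apply: emeasurable_funM => //; apply/measurable_EFinP.
  by apply: measurableT_comp; [exact: measurable_indic|exact: measurable_snd].
have K0 z : (0 <= K z)%E by rewrite mule_ge0// lee_fin ?sqr_ge0// indicE.
have KE x s : K (x, s) = (((fun s => (k x s ^+ 2)%:E) \_ J) s).
  by rewrite /K patchE indicE/=; case: ifPn => _; rewrite ?mule1 ?mule0.
have KE' x s : K (x, s) = ((\1_J s)%:E * (k x s ^+ 2)%:E)%E by rewrite /K muleC.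
clearbody K.
have inner x : (\int[mu]_s K (x, s) = (\int[mu]_(s in `[0, h]) (k x s ^+ 2))%:E)%E.
  under eq_integral do rewrite KE.
  rewrite -integral_mkcond /Rintegral fineK//.
  by apply: integrable_fin_num (continuous_itv_integrable 0 h (ck2 x)).
have tonelli := @fubini_tonelli _ _ _ _ R mu mu K mK K0.
have mI : measurable_fun setT ((v \o flow h) \- v).
  have mv := continuous_measurable cv.
  by apply: measurable_funB; [exact: measurable_comp_flow mv|exact: mv].
have step1 : (sqint ((v \o flow h) \- v)%R <= h%:E * \int[mu]_x \int[mu]_s K (x, s))%E.
  rewrite -ge0_integralZl//; last 3 first.
  - exact: measurable_fun_fubini_tonelli_F.
  - by move=> x _; apply: integral_ge0.
  - by rewrite lee_fin ltW.
  apply: ge0_le_integral => //.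
  - by move=> x _; rewrite lee_fin sqr_ge0.
  - exact: measurable_sqr.
  - by apply: measurable_funeM; exact: measurable_fun_fubini_tonelli_F.
  - move=> x _; rewrite inner -EFinM lee_fin /= incr.
    exact: sqr_integral_le.
apply: (le_trans step1); rewrite tonelli expr2 -mulrA EFinM -muleA.
apply: lee_wpmul2l; first by rewrite lee_fin ltW.
apply: (@le_trans _ _ (\int[mu]_(s in J) ((expR h)%:E * sqint (transport v)))%E).
  rewrite [leRHS]integral_mkcond; apply: ge0_le_integral => //.
  - by move=> s _; apply: integral_ge0.
  - exact: measurable_fun_fubini_tonelli_G.
  - by apply/(measurable_restrictT _ _).1.
  - move=> s _; rewrite patchE; case: ifPn => [sJ|sJ].
      have [s0 sh] : 0 <= s /\ s <= h by move: sJ; rewrite inE /J /= in_itv/= => /andP.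
      under eq_integral do rewrite KE' indicE sJ mul1e.
      apply: le_trans (sqint_flow s mT) _; apply: lee_wpmul2r; first exact: sqint_ge0.
      by rewrite lee_fin ler_expR ger0_norm.
    by under eq_integral do rewrite KE' indicE (negbTE sJ) mul0e; rewrite integral0.
have mJh : mu J = h%:E by rewrite /J lebesgue_measure_itv/= lte_fin h0 -EFinB subr0.
rewrite integral_cst//.
by rewrite -[leLHS]/((expR h)%:E * sqint (transport v) * mu J)%E mJh muleC muleA -EFinM.
Qed.

(** Negative times reduce to positive ones by the change of variables flow h,
    which costs a further factor expR |h|. *)
Lemma sqint_flow_increment v h : C10 v ->
  (sqint ((v \o flow h) \- v)%R <=
    (h ^+ 2 * expR `|h| ^+ 2)%:E * sqint (transport v))%E.
Proof.
move=> vC; have cv := C10_continuous vC.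
have e1 : 1 <= expR `|h| by rewrite -expR0 ler_expR.
have mI s : measurable_fun setT ((v \o flow s) \- v).
  have mv := continuous_measurable cv.
  by apply: measurable_funB => //; exact: measurable_comp_flow mv.
have [h0|h0|->] := ltgtP h 0; last first.
- rewrite (_ : _ \- _ = cst 0).
    rewrite /sqint; under eq_integral do rewrite /= expr0n/=.
    by rewrite integral0 mule_ge0// ?sqint_ge0// lee_fin mulr_ge0 ?sqr_ge0.
  by apply/funext => x /=; rewrite flow_0x subrr.
- apply: le_trans (sqint_flow_increment_pos vC h0) _.
  apply: lee_wpmul2r; first exact: sqint_ge0.
  rewrite lee_fin ler_wpM2l ?sqr_ge0// (expr2 (expR _)) gtr0_norm//.
  by rewrite gtr0_norm// in e1; rewrite ler_peMl// expR_ge0.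
- have nh : 0 < - h by rewrite oppr_gt0.
  have -> : sqint ((v \o flow h) \- v)%R = sqint (((v \o flow (- h)) \- v) \o flow h)%R.
    rewrite /sqint; apply: eq_integral => x _ /=.
    by rewrite flowK -[in RHS]opprB sqrrN.
  apply: le_trans (sqint_flow h (mI (- h))) _.
  rewrite ltr0_norm// (expr2 (expR _)) mulrCA EFinM -muleA.
  apply: lee_wpmul2l; first by rewrite lee_fin expR_ge0.
  by rewrite -(sqrrN h); exact: sqint_flow_increment_pos.
Qed.

End DifferenceQuotient.

(** * Mean-square limits at time zero *)

Section Limits.
Context {R : realType}.
Notation mu := (@lebesgue_measure R).
Implicit Types (v w : R -> R) (t s h x : R).

Lemma cvg_dnbhs_nbhs (T : topologicalType) (f : R -> T) (a : R) :
  f x @[x --> a^'] --> f a -> f x @[x --> a] --> f a.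
Proof.
move=> fa A Aa; have h : \forall x \near a, x != a -> A (f x) := fa A Aa.
apply: filterS h => x /=; have [->|_] := eqVneq x a; last exact.
by move=> _; exact: nbhs_singleton.
Qed.

Lemma cvg_translate (T : topologicalType) (f : R -> T) (a : R) (F : set_system T) :
  f (a + h) @[h --> (0 : R)] --> F -> f t @[t --> a] --> F.
Proof.
move=> fa; have h : (t - a) @[t --> a] --> (0 : R).
  by rewrite -(subrr a); apply: cvgB; [exact: cvg_id|exact: cvg_cst].
rewrite (_ : f = (fun h => f (a + h)) \o (fun t => t - a)).
  exact: cvg_comp h fa.
by apply/funext => t /=; rewrite addrC subrK.
Qed.

Lemma cvg_expR_norm (F : set_system R) {FF : Filter F} : h @[h --> F] --> (0 : R) ->
  expR `|h| @[h --> F] --> (1 : R).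
Proof.
move=> h0; rewrite -(@expR0 R); apply: continuous_cvg; first exact: continuous_expR.
by rewrite -(@normr0 _ R); exact: cvg_norm.
Qed.

Lemma cvg_dnbhs_id (a : R) : h @[h --> a^'] --> a.
Proof. exact: cvg_within. Qed.

Lemma cvg_sqr (F : set_system R) {FF : Filter F} (f : R -> R) (l : R) :
  f h @[h --> F] --> l -> f h ^+ 2 @[h --> F] --> l ^+ 2.
Proof.
move=> fl; rewrite expr2 (_ : (fun h => f h ^+ 2) = f \* f); first exact: cvgM.
by apply/funext => h; rewrite expr2.
Qed.

Lemma sqint_cvg0D (F : set_system R) (FF : Filter F) (f g : R -> R -> R) :
  (forall h, measurable_fun setT (f h)) -> (forall h, measurable_fun setT (g h)) ->
  sqint (f h) @[h --> F] --> 0%E -> sqint (g h) @[h --> F] --> 0%E ->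
  sqint (f h \+ g h)%R @[h --> F] --> 0%E.
Proof.
move=> mf mg f0 g0.
apply: (@squeeze_cvge _ _ _ _ (cst 0%E) _
  (fun h => (2%:E * sqint (f h) + 2%:E * sqint (g h))%E)).
- by apply: filterE => h; rewrite sqint_ge0 sqintD.
- exact: cvg_cst.
have two : (2%:E : \bar R) \is a fin_num by [].
have f2 := cvgeZl two f0; have g2 := cvgeZl two g0; rewrite mule0 in f2 g2.
by rewrite -[X in _ --> X](adde0 0%E); apply: cvgeD.
Qed.

Lemma slope_cvg x : slope h x @[h --> (0 : R)^'] --> (1 : R).
Proof.
have e1 : expR `|h| @[h --> (0 : R)^'] --> (1 : R).
  exact: cvg_expR_norm (@cvg_dnbhs_id 0).
have e2 : expR (- `|h|) @[h --> (0 : R)^'] --> (1 : R).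
  rewrite -(@expR0 R); apply: continuous_cvg; first exact: continuous_expR.
  rewrite -[X in _ --> X]oppr0; apply: cvgN; rewrite -[X in _ --> X](@normr0 _ R).
  by apply: cvg_norm; exact: cvg_dnbhs_id.
apply: (squeeze_cvgr _ e2 e1).
by apply: filterE => h; exact: slope_bounds.
Qed.

Lemma flow_comp_cvg (f : R -> R) x : {for x, continuous f} ->
  f (flow h x) @[h --> (0 : R)^'] --> f x.
Proof.
move=> fx; apply: (@cvg_comp _ _ _ (flow ^~ x) f) fx.
exact: cvg_comp (@cvg_dnbhs_id 0) (@flow_cvg_t0 R x).
Qed.

Definition drift_coef (M : R) h : R := (expR `|h| - 1) * M * (2 + `|h|).

Lemma drift_coef_cvg (M : R) (F : set_system R) {FF : Filter F} :
  h @[h --> F] --> (0 : R) -> drift_coef M h @[h --> F] --> (0 : R).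
Proof.
move=> h0; have e1 := cvg_expR_norm h0.
have e2 : (expR `|h| - 1) * M @[h --> F] --> (1 - 1) * M.
  by apply: cvgMr_tmp; apply: cvgB; [exact: e1|exact: cvg_cst].
have e3 : 2 + `|h| @[h --> F] --> 2 + `|0 : R|.
  by apply: cvgD; [exact: cvg_cst|exact: cvg_norm].
have e4 : drift_coef M h @[h --> F] --> (1 - 1) * M * (2 + `|0 : R|).
  exact: cvgM e2 e3.
by rewrite subrr !mul0r in e4.
Qed.

Lemma sqint_drift_cvg v : C10 v -> sqint (drift h v) @[h --> (0 : R)^'] --> 0%E.
Proof.
move=> vC; have cv := C10_continuous vC; have [M M0 vM] := C10_bounded vC.
apply: (@sqint_squeeze _ _ _ _ (fun h => drift_coef M h ^+ 2 * fine (sqint (@decay R)))).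
  apply: filterE => h; apply: sqint_le_decay.
  - exact: measurable_drift.
  - exact: drift_coef_ge0.
  - by move=> x; exact: drift_bound.
rewrite -[X in _ --> X](mul0r (fine (sqint (@decay R)))); apply: cvgMr_tmp.
have h0 : drift_coef M h @[h --> (0 : R)^'] --> (0 : R).
  by apply: drift_coef_cvg; exact: cvg_dnbhs_id.
have h1 := cvg_sqr h0; rewrite expr0n in h1; exact: h1.
Qed.

(** The transported part converges because its norm does not grow in the limit,
    the nonlocal part because it is dominated by a small multiple of decay. *)
Lemma sqint_evol_cvg v : C10 v -> L2 v -> sqint (evol h v \- v) @[h --> (0 : R)^'] --> 0%E.
Proof.
move=> vC lv; have cv := C10_continuous vC; have mv := continuous_measurable cv.
have -> : (fun h => sqint (evol h v \- v)) =
    (fun h => sqint (((v \o flow h) \- v) \+ drift h v)%R).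
  apply/funext => h; congr sqint; apply/funext => x.
  by rewrite /evol /drift /=; ring.
have mvf h := measurable_comp_flow h mv.
apply: sqint_cvg0D.
- by move=> h; exact: measurable_funB.
- by move=> h; exact: measurable_drift.
- apply: (@sqint_cvg _ (fun h => v \o flow h) v (fun h => expR `|h|)) => //.
  + by move=> x _; apply: flow_comp_cvg; exact: cv.
  + by move=> h _; exact: sqint_flow.
  + exact: cvg_expR_norm (@cvg_dnbhs_id 0).
- exact: sqint_drift_cvg.
Qed.

Lemma sqint_evol_dx_cvg v : C10 v -> H1 v ->
  sqint (evol_dx h v \- derive1 v) @[h --> (0 : R)^'] --> 0%E.
Proof.
move=> vC vH; have [lv ldv] := (C10_H1P vC).1 vH.
have cv := C10_continuous vC; have mv := continuous_measurable cv.
have /L2P[mdv _] := ldv.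
pose A h x := derive1 v (flow h x) * slope h x.
pose B h x := - (Num.sg x * drift h v x).
pose C h x := gain h x * (v (flow h x) * slope h x).
have mA h : measurable_fun setT (A h) by have /L2P[] := L2_slope h ldv.
have mB h : measurable_fun setT (B h).
  apply: measurableT_comp => //; apply: measurable_funM.
    exact: measurable_sgr.
  exact: measurable_drift.
have mC h : measurable_fun setT (C h) by have /L2P[] := L2_gain h lv.
have -> : (fun h => sqint (evol_dx h v \- derive1 v)) =
    (fun h => sqint (((A h \- derive1 v) \+ B h) \+ C h)%R).
  apply/funext => h; congr sqint; apply/funext => x.
  by rewrite /= evol_dx_drift /A /B /C; ring.
have e1 : expR `|h| @[h --> (0 : R)^'] --> (1 : R).
  exact: cvg_expR_norm (@cvg_dnbhs_id 0).
apply: sqint_cvg0D => //.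
- by move=> h; apply: measurable_funD => //; exact: measurable_funB.
- apply: sqint_cvg0D => //.
  + by move=> h; exact: measurable_funB.
  + apply: (@sqint_cvg _ A (derive1 v) (fun h => expR `|h| ^+ 2 * expR `|h|)) => //.
    * move=> x x0; rewrite -[X in _ --> X]mulr1; apply: cvgM; last exact: slope_cvg.
      by apply: flow_comp_cvg; have [_ dv _ _] := vC; exact: (dv _ x0).2.
    * move=> h _; apply: (@le_trans _ _ (sqint (fun x => expR `|h| * derive1 v (flow h x)))).
        apply: le_sqint => //; first by apply: measurable_funM => //; exact: measurable_comp_flow.
        move=> x; rewrite /A (normrM (derive1 v _)) (normrM (expR _)) mulrC ler_wpM2r//.
        rewrite (gtr0_norm (slope_gt0 h x)) (ger0_norm (expR_ge0 _)).
        by have /andP[] := slope_bounds h x.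
      rewrite sqintZ; last exact: measurable_comp_flow.
      rewrite [leRHS](_ : _ = ((expR `|h| ^+ 2)%:E
        * ((expR `|h|)%:E * sqint (derive1 v)))%E); last by rewrite muleA -EFinM.
      apply: lee_wpmul2l; first by rewrite lee_fin sqr_ge0.
      exact: sqint_flow.
    * rewrite -[X in _ --> X]mulr1; apply: cvgM => //.
      by have h1 := cvg_sqr e1; rewrite expr1n in h1; exact: h1.
  + apply: (@squeeze_cvge _ _ _ _ (cst 0%E) _ (fun h => sqint (drift h v))).
    * apply: filterE => h; rewrite sqint_ge0/=; apply: le_sqint => //.
        exact: measurable_drift.
      by move=> x; rewrite /B normrN (normrM (Num.sg x)) normr_sg ler_piMl// lern1 leq_b1.
    * exact: cvg_cst.
    * exact: sqint_drift_cvg.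
- have [I IE] : exists I, sqint v = I%:E.
    by have /L2P[_ h] := lv; exists (fine (sqint v)); rewrite fineK// ge0_fin_numE// sqint_ge0.
  apply: (@sqint_squeeze _ _ _ _ (fun h => ((expR `|h| - 1) * expR `|h|) ^+ 2 * expR `|h| * I)).
    apply: filterE => h.
    apply: (@le_trans _ _ (sqint (fun x => ((expR `|h| - 1) * expR `|h|) * v (flow h x)))).
      apply: le_sqint => //; first by apply: measurable_funM => //; exact: measurable_comp_flow.
      move=> x; rewrite /C (normrM (gain h x)) (normrM (v _)) (normrM (_ * _)) (normrM (_ - 1)).
      rewrite -[leRHS]mulrA [X in _ <= _ * X]mulrC.
      have /andP[p0 p1] := peakon_bounds x; have [_ f1 _ _] := expR_bounds h.
      apply: ler_pM => //; last first.
        rewrite ler_wpM2l// (gtr0_norm (slope_gt0 h x)) (ger0_norm (expR_ge0 _)).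
        by have /andP[] := slope_bounds h x.
      rewrite [leRHS]ger0_norm ?subr_ge0//; apply: le_trans (gain_bound h x) _.
      by rewrite ler_piMl// subr_ge0.
    rewrite sqintZ; last exact: measurable_comp_flow.
    rewrite [leRHS](_ : _ = ((((expR `|h| - 1) * expR `|h|) ^+ 2)%:E
      * (expR `|h| * I)%:E)%E); last by rewrite -EFinM mulrA.
    apply: lee_wpmul2l; first by rewrite lee_fin sqr_ge0.
    by rewrite EFinM -IE; exact: sqint_flow.
  have z : ((expR `|h| - 1) * expR `|h|) @[h --> (0 : R)^'] --> (0 : R).
    have h1 : ((expR `|h| - 1) * expR `|h|) @[h --> (0 : R)^'] --> (1 - 1) * (1 : R).
      by apply: cvgM => //; apply: cvgB => //; exact: cvg_cst.
    by rewrite subrr mul0r in h1.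
  rewrite -[X in _ --> X](mul0r I); apply: cvgMr_tmp.
  rewrite -[X in _ --> X](mul0r 1); apply: cvgM => //.
  have h1 := cvg_sqr z; rewrite expr0n in h1; exact: h1.
Qed.

End Limits.

(** * Continuity in H1 and the equation in the mean-square sense *)

Section Existence.
Context {R : realType}.
Notation mu := (@lebesgue_measure R).
Implicit Types (v w : R -> R) (t s h x : R).

Lemma cvg_eqfun (U : topologicalType) (F : set_system R) (f g : R -> U)
    (l : set_system U) :
  (forall h, f h = g h) -> g h @[h --> F] --> l -> f h @[h --> F] --> l.
Proof. by move=> /funext ->. Qed.

Lemma derive1B v w x : C10 v -> C10 w -> x != 0 ->
  derive1 (v \- w) x = derive1 v x - derive1 w x.
Proof.
move=> vC wC x0; apply: is_derive_derive1.
by apply: is_deriveB; exact: C10_is_derive.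
Qed.
Lemma C10_B v w : C10 v -> C10 w -> C10 (v \- w).
Proof.
move=> vC wC; have [cv dv [lv rv] _] := vC; have [cw dw [lw rw] _] := wC.
have [M M0 vM] := C10_bounded vC; have [N N0 wN] := C10_bounded wC.
have [M' M'0 vM'] := C10_derive_bounded vC; have [N' N'0 wN'] := C10_derive_bounded wC.
have dE x := @derive1B v w x vC wC.
have sidecvg (F : set_system R) (FF : Filter F) : (\forall x \near F, x != 0) ->
    cvg (derive1 v x @[x --> F]) -> cvg (derive1 w x @[x --> F]) ->
    cvg (derive1 (v \- w) x @[x --> F]).
  move=> F0 /cvg_ex[l vl] /cvg_ex[m wm]; apply/cvg_ex; exists (l - m).
  apply: near_cvg (cvgB vl wm).
  by apply: filterS F0 => x /dE.
split.
- by move=> x; apply: cvgB; [exact: cv|exact: cw].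
- move=> x x0; split.
    by apply: derivableB; [have [] := dv _ x0|have [] := dw _ x0].
  rewrite /prop_for /continuous_at dE//.
  apply: near_cvg (cvgB (dv _ x0).2 (dw _ x0).2).
  by apply: filterS (near_neq0 x0) => y /dE.
- split; [apply: (sidecvg _ _ _ lv lw)|apply: (sidecvg _ _ _ rv rw)].
    have : \forall y \near 0^'-, y < (0 : R) by exact: nbhs_left_lt.
    by apply: filterS => y y0; rewrite lt_eqF.
  have : \forall y \near 0^'+, (0 : R) < y by exact: nbhs_right_gt.
  by apply: filterS => y y0; rewrite gt_eqF.
- split; apply/bounded_onP.
    exists (M + N) => [|x _]; first by rewrite addr_ge0.
    by rewrite (le_trans (ler_normB _ _))// lerD.
  exists (M' + N') => [|x /= x0]; first by rewrite addr_ge0.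
  by rewrite dE// (le_trans (ler_normB _ _))// lerD// ?vM'// wN'.
Qed.

Lemma H1_B v w : C10 v -> C10 w -> H1 v -> H1 w -> H1 (v \- w).
Proof.
move=> vC wC /(C10_H1P vC)[lv ldv] /(C10_H1P wC)[lw ldw].
apply/(C10_H1P (C10_B vC wC)); split; first exact: L2B.
apply: eq_L2 (L2B ldv ldw) => [|x x0]; last exact: derive1B.
exact: measurable_derive1 (C10_B vC wC).
Qed.

Lemma evolDl t h v : C10 v -> evol (t + h) v = evol h (evol t v).
Proof. by move=> vC; rewrite addrC evolD//; exact: C10_continuous. Qed.

Lemma gain_0x x : gain 0 x = 0.
Proof. by rewrite /gain mulr0 /hgain oppr0 expR0 subrr !mulr0. Qed.

Lemma slope_0x x : slope 0 x = 1.
Proof. by rewrite /slope gain_0x mulr0 subr0 invr1. Qed.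

Lemma evol_dx_0 v x : evol_dx 0 v x = derive1 v x.
Proof. rewrite /evol_dx flow_0x gain_0x slope_0x; ring. Qed.

Lemma sqint_cst0 : sqint (cst (0 : R)) = 0%E.
Proof.
by rewrite /sqint; under eq_integral do rewrite /= expr0n/=; exact: integral0.
Qed.

Lemma H1norm_evol_cvg w : C10 w -> H1 w ->
  H1norm (evol h w \- w) @[h --> (0 : R)] --> 0%E.
Proof.
move=> wC wH; have [lw ldw] := (C10_H1P wC).1 wH.
have eC h := C10_evol h wC.
have eH h := H1_evol h wC wH.
rewrite (_ : (fun h => H1norm (evol h w \- w)) =
    fun h => ((sqint (evol h w \- w)%R + sqint (evol_dx h w \- derive1 w)%R) `^ 2^-1)%E); last first.
  apply/funext => h; rewrite (C10_H1norm (C10_B (eC h) wC) (H1_B (eC h) wC (eH h) wH)).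
  congr ((_ + _) `^ _)%E; apply: eq_sqint_neq0.
  - exact: measurable_derive1 (C10_B (eC h) wC).
  - apply: measurable_funB; first exact: measurable_evol_dx.
    exact: measurable_derive1.
  - by move=> x x0; rewrite (derive1B (eC h) wC x0) (derive1_evol h wC x0).
apply: sqrte_cvg0; first by move=> h; rewrite adde_ge0// sqint_ge0.
pose F h := (sqint (evol h w \- w)%R + sqint (evol_dx h w \- derive1 w)%R)%E.
have z : F 0 = 0%E.
  rewrite /F (_ : evol 0 w \- w = cst 0); last first.
    by apply/funext => x; rewrite /= evol0 subrr.
  rewrite (_ : evol_dx 0 w \- derive1 w = cst 0); last first.
    by apply/funext => x; rewrite /= evol_dx_0 subrr.
  by rewrite sqint_cst0 adde0.
suff : F h @[h --> (0 : R)] --> F 0 by rewrite z.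
apply: cvg_dnbhs_nbhs; rewrite z -[X in _ --> X](adde0 0%E); apply: cvgeD.
- by [].
- exact: sqint_evol_cvg.
- exact: sqint_evol_dx_cvg.
Qed.

(** By the group property, continuity in time only has to be checked at time 0,
    for the datum evol t0 v. *)
Lemma evol_continuous_H1 v : C10 v -> H1 v -> continuous_into_H1 (fun t => evol t v).
Proof.
move=> vC vH; split => [t|t0]; first exact: H1_evol.
apply: cvg_translate.
have h0 := H1norm_evol_cvg (C10_evol t0 vC) (H1_evol t0 vC vH).
by apply: cvg_eqfun h0 => h; rewrite (evolDl t0 h vC).
Qed.

(** The upper estimate of expR (- y) is the reciprocal of the lower one of expR y,
    as 1 / (1 + y) <= 1 - y + 2 y^2 for y >= - 1 / 2. *)
Lemma expR_second_order (y : R) : `|y| <= 2^-1 -> `|1 - expR (- y) - y| <= 2 * y ^+ 2.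
Proof.
rewrite ler_norml => /andP[y1 y2]; have a1 := expR_ge1Dx (- y); have b1 := expR_ge1Dx y.
have ab : expR (- y) * expR y = 1 by rewrite -expRD addNr expR0.
have a0 := expR_gt0 (- y); set a := expR (- y) in a1 ab a0 *.
have ay : a * (1 + y) <= 1 by rewrite -[leRHS]ab ler_wpM2l// ltW.
rewrite ler_norml; apply/andP; split; last by have := sqr_ge0 y; lra.
have y3 : 0 < 1 + y by lra.
have : a <= 1 - y + 2 * y ^+ 2.
  rewrite -(ler_pM2r y3); apply: le_trans ay _.
  have : 0 <= y ^+ 2 * (1 + 2 * y) by rewrite mulr_ge0 ?sqr_ge0//; lra.
  lra.
lra.
Qed.

Lemma gain_rate h x : h != 0 -> `|h| <= 2^-1 -> x != 0 ->
  `|h^-1 * gain h x - peakon x| <= 2 * `|h| * peakon x.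
Proof.
move=> h0 h1 x0; have s2 := sgr_sqr x0; have p0 := expR_ge0 (- `|x|).
pose y := Num.sg x * h.
have yh : `|y| = `|h| by rewrite normrM normr_sg x0 mul1r.
have y0 : y != 0 by rewrite -normr_eq0 yh normr_eq0.
have s0 : Num.sg x != 0 by rewrite sgr_eq0.
have E : h^-1 * gain h x - peakon x = peakon x * ((1 - expR (- y) - y) / y).
  rewrite /gain /hgain -/y -/(peakon x) (_ : h^-1 = Num.sg x / y); last first.
    by rewrite /y; field; rewrite h0 s0.
  transitivity (peakon x * ((Num.sg x * Num.sg x) * (1 - expR (- y)) / y - 1)).
    by field.
  by rewrite s2; field.
rewrite E (normrM (peakon x)) ger0_norm// mulrC ler_wpM2r// normrM normfV.
rewrite ler_pdivrMr ?normr_gt0//; apply: le_trans (expR_second_order _) _.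
  by rewrite yh.
by rewrite -yh -mulrA -expr2 real_normK ?num_real.
Qed.

Lemma decay_le1 x : decay x <= 1.
Proof. by rewrite /decay -expR0 ler_expR oppr_le0 divr_ge0. Qed.

Lemma peakon_decay x : peakon x <= decay x.
Proof. by rewrite ler_expR lerN2 ler_pdivrMr// ler_peMr// ler1n. Qed.

(** The error has two sources, the gain being only nearly linear in h and the
    primitive being taken at a displaced point; both are of first order in h
    and, by peakon_growth, dominated by decay. *)
Lemma drift_rate w (M : R) h x : continuous w -> (forall z, `|w z| <= M) ->
  h != 0 -> `|h| <= 2^-1 ->
  `|h^-1 * drift h w x - peakon x * primitive w x| <= 6 * M * `|h| * decay x.
Proof.
move=> cw wM h0 h1; have M0 : 0 <= M by exact: le_trans (wM 0).
have [->|x0] := eqVneq x 0.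
  rewrite /drift flow_t0 primitive0 !mulr0 subrr normr0.
  by rewrite mulr_ge0 ?decay_ge0// mulr_ge0// mulr_ge0.
have g := gain_rate h0 h1 x0; have fl := flow_near h x.
have V1 := primitive_bound (flow h x) cw wM; have V2 := primitive_lip x (flow h x) cw wM.
have pd := peakon_decay x; have pg := peakon_growth x; have p0 := expR_ge0 (- `|x|).
have d0 := decay_ge0 x; rewrite -/(peakon x) in p0; rewrite -/(decay x) in pg.
have h5 : `|flow h x| <= `|x| + `|h|.
  by rewrite -[flow h x](subrK x) addrC (le_trans (ler_normD _ _))// lerD2l.
have E : h^-1 * drift h w x - peakon x * primitive w x =
  (h^-1 * gain h x - peakon x) * primitive w (flow h x)
  + peakon x * (primitive w (flow h x) - primitive w x) by rewrite /drift; ring.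
rewrite E; apply: le_trans (ler_normD _ _) _.
have hh := normr_ge0 h.
have A1 : `|(h^-1 * gain h x - peakon x) * primitive w (flow h x)| <=
    (2 * `|h| * peakon x) * (M * (`|x| + `|h|)).
  rewrite normrM; apply: ler_pM => //; apply: le_trans V1 _.
  by rewrite ler_wpM2l.
have A2 : `|peakon x * (primitive w (flow h x) - primitive w x)| <= decay x * (M * `|h|).
  rewrite normrM (ger0_norm p0); apply: ler_pM => //; apply: le_trans V2 _.
  by rewrite ler_wpM2l.
(* The constant 5 / 2 is 2 from peakon_growth and 1 / 2 from the bound on h; with
   the term A2 this gives 6 = 2 * (5 / 2) + 1. *)
have A3 : (2 * `|h| * peakon x) * (M * (`|x| + `|h|)) <= 2 * `|h| * M * ((5/2) * decay x).
  rewrite (_ : (2 * `|h| * peakon x) * (M * (`|x| + `|h|)) =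
    2 * `|h| * M * (peakon x * `|x| + peakon x * `|h|)); last by ring.
  apply: ler_wpM2l; first by rewrite !mulr_ge0.
  have : peakon x * `|h| <= decay x * 2^-1 by apply: ler_pM.
  lra.
apply: le_trans (lerD A1 A2) _; apply: le_trans (lerD A3 (lexx _)) _.
rewrite -subr_ge0 [leRHS](_ : _ = 0); last by field.
by [].
Qed.

Lemma quotient_from_is_derive (f : R -> R) (s d : R) : is_derive s 1 f d ->
  h^-1 * (f (s + h) - f s) @[h --> (0 : R)^'] --> d.
Proof.
move=> [df <-]; move: df; rewrite /derivable /derive => df.
have E : (fun h => h^-1 * (f (s + h) - f s)) = (fun h => h^-1 *: (f (h *: 1 + s) - f s)).
  by apply/funext => h; rewrite /GRing.scale/= mulr1 (addrC h).
by rewrite E.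
Qed.
(** For the local part the convergence is again pointwise convergence with a
    control of the norm, given here by sqint_flow_increment. The nonlocal part is
    bounded directly by a multiple of |h|. *)
Lemma sqint_evol_derive w : C10 w -> H1 w ->
  sqint (fun x => h^-1 * (evol h w x - w x) - opA w x) @[h --> (0 : R)^'] --> 0%E.
Proof.
move=> wC wH; have [lw ldw] := (C10_H1P wC).1 wH.
have cw := C10_continuous wC; have mw := continuous_measurable cw.
have [M M0 wM] := C10_bounded wC.
pose F h x := h^-1 * (w (flow h x) - w x).
pose G h x := h^-1 * drift h w x - peakon x * primitive w x.
have mI h : measurable_fun setT (fun x => w (flow h x) - w x).
  by apply: measurable_funB => //; exact: measurable_comp_flow mw.
have mF h : measurable_fun setT (F h) by exact: measurable_funM.
have mT : measurable_fun setT (transport w).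
  by apply: continuous_measurable; exact: continuous_transport.
have mG h : measurable_fun setT (G h).
  apply: measurable_funB; first by apply: measurable_funM => //; exact: measurable_drift.
  apply: measurable_funM; apply: continuous_measurable.
    exact: continuous_peakon.
  exact: continuous_primitive.
have -> : (fun h => sqint (fun x => h^-1 * (evol h w x - w x) - opA w x)) =
    (fun h => sqint ((F h \- transport w) \+ G h)%R).
  apply/funext => h; congr sqint; apply/funext => x.
  by rewrite /F /G /= /opA /transport /evol /drift; ring.
apply: sqint_cvg0D => //; first by move=> h; exact: measurable_funB.
- have e1 : expR `|h| @[h --> (0 : R)^'] --> (1 : R).
    exact: cvg_expR_norm (@cvg_dnbhs_id R 0).
  apply: (@sqint_cvg _ F (transport w) (fun h => expR `|h| ^+ 2)) => //.
  + exact: L2_transport.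
  + move=> x x0; have := quotient_from_is_derive (is_derive_flow_comp 0 x wC).
    by rewrite !flow_0x; under eq_fun do rewrite add0r.
  + move=> h h0; rewrite /F sqintZ//.
    have := sqint_flow_increment h wC => hi.
    apply: (@le_trans _ _ ((h^-1 ^+ 2)%:E * ((h ^+ 2 * expR `|h| ^+ 2)%:E * sqint (transport w)))%E).
      by apply: lee_wpmul2l => //; rewrite lee_fin sqr_ge0.
    rewrite muleA -EFinM mulrA -exprMn mulVf// expr1n mul1r.
    by [].
  + have h1 := cvg_sqr e1; rewrite expr1n in h1; exact: h1.
- apply: (@sqint_squeeze _ _ _ _ (fun h => (6 * M * `|h|) ^+ 2 * fine (sqint (@decay R)))).
    have h0 : \forall h \near (0 : R)^', h != 0 by exact: nbhs_dnbhs_neq.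
    have h1 : \forall h \near (0 : R)^', `|h| <= 2^-1 by apply: dnbhs0_le; rewrite invr_gt0.
    apply: filterS2 h0 h1 => h h0 h1; apply: sqint_le_decay => //.
      by rewrite !mulr_ge0.
    by move=> x; exact: drift_rate.
  rewrite -[X in _ --> X](mul0r (fine (sqint (@decay R)))); apply: cvgMr_tmp.
  have z : 6 * M * `|h| @[h --> (0 : R)^'] --> 6 * M * `|0 : R|.
    by apply: cvgMl_tmp; apply: cvg_norm; exact: cvg_dnbhs_id.
  rewrite normr0 mulr0 in z.
  have h1 := cvg_sqr z; rewrite expr0n in h1; exact: h1.
Qed.

Lemma evol_solves v : C10 v -> H1 v -> solves_evolution (fun t => evol t v).
Proof.
move=> vC vH t; split; last by move=> x; exact: is_derive_evol_t.
apply: L2norm_cvg0.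
have h0 := sqint_evol_derive (C10_evol t vC) (H1_evol t vC vH).
by apply: cvg_eqfun h0 => h; rewrite (evolDl t h vC).
Qed.

End Existence.

(** * Continuity in C10 *)

Section ContinuityC10.
Context {R : realType}.
Implicit Types (v w : R -> R) (t s h x K e : R).

Lemma near_translate (a : R) (P : R -> Prop) :
  (\forall h \near (0 : R), P (a + h)) -> \forall t \near a, P t.
Proof.
move=> Pa; have h : (t - a) @[t --> a] --> (0 : R).
  by rewrite -[X in _ --> X](subrr a); apply: cvgB; [exact: cvg_id|exact: cvg_cst].
have : \forall t \near a, P (a + (t - a)) by exact: (h _ Pa).
by apply: filterS => t; rewrite addrC subrK.
Qed.

Lemma near_reflect (P : R -> Prop) :
  (\forall h \near (0 : R), P h) -> \forall h \near (0 : R), P (- h).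
Proof.
move=> P0; have h : (- h) @[h --> (0 : R)] --> - (0 : R) by apply: cvgN; exact: cvg_id.
by rewrite oppr0 in h; exact: (h _ P0).
Qed.

(** Uniform continuity on the compact interval from 0 to K, corner included: on
    each side of 0 the derivative has a continuous extension, and the flow does
    not change sides. *)
Lemma half_C1_flow_unif w g K e : half_C1 w g -> 0 < e ->
  \forall h \near (0 : R), forall x, 0 < x -> x <= K ->
    `|derive1 w (flow h x) - derive1 w x| < e.
Proof.
move=> wg e0; have /compact_near_coveringP cov := @segment_compact R 0 K.
pose P h x := 0 <= x -> `|g (flow h x) - g x| < e.
have : \forall h \near (0 : R), `[0, K] `<=` P h.
  apply: (cov R (nbhs (0 : R)) P) => x /=; rewrite in_itv/= => /andP[x0 _].
  have e2 : 0 < e / 2 by rewrite divr_gt0.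
  have /cvgrPdist_lt/(_ _ e2) := wg.2 _ x0.
  move=> /nbhs_ballP[d /= d0 hd].
  have d2 : 0 < d / 2 by rewrite divr_gt0.
  exists (ball x (d / 2), ball (0 : R) (d / 2)) => /=.
    by split; exact: nbhsx_ballx.
  move=> [y h] /= [yx h0] y0.
  have hl : `|h| < d / 2 by move: h0; rewrite /ball/= sub0r normrN.
  have yl : `|x - y| < d / 2 by [].
  have A1 : `|g x - g y| < e / 2 by apply: hd => /=; apply: lt_trans yl _; rewrite ltr_pdivrMr// ltr_pMr// ltr1n.
  have A2 : `|g x - g (flow h y)| < e / 2.
    apply: hd => /=; rewrite /ball/= (_ : x - flow h y = (x - y) + (y - flow h y)); last by ring.
    apply: le_lt_trans (ler_normD _ _) _; rewrite (splitr d) ltrD//.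
    by rewrite distrC; exact: le_lt_trans (flow_near h y) hl.
  rewrite (_ : g (flow h y) - g y = (g x - g y) - (g x - g (flow h y))); last by ring.
  apply: le_lt_trans (ler_normB _ _) _.
  by rewrite (splitr e) ltrD.
apply: filterS => h hP x x0 xK.
rewrite (half_C1_derive1 wg x0) (half_C1_derive1 wg (flow_gt0 h x0)).
by apply: hP => //=; rewrite ?in_itv/= ?(ltW x0).
Qed.

Lemma derive1_flow_unif w K e : C10 w -> 0 < e ->
  \forall h \near (0 : R), forall x, x != 0 -> `|x| <= K ->
    `|derive1 w (flow h x) - derive1 w x| < e.
Proof.
move=> wC e0; have [g1 wg1] := C10_half wC; have [g2 wg2] := C10_half (C10_reflect wC).
have n1 := half_C1_flow_unif K wg1 e0.
have n2 := near_reflect (half_C1_flow_unif K wg2 e0).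
have dr x : x != 0 -> derive1 (w \o -%R) x = - derive1 w (- x).
  move=> x0; have nx : - x != 0 by rewrite oppr_eq0.
  by apply: is_derive_derive1; apply: derive1_reflect; have [] := C10_is_derive wC nx.
apply: filterS2 n1 n2 => h h1 h2 x x0 xK.
move: (x0); rewrite neq_lt => /orP[xn|xp]; last first.
  by apply: h1 => //; rewrite (le_trans (ler_norm _)).
have nx : 0 < - x by rewrite oppr_gt0.
have nK : - x <= K by rewrite -normrN in xK; apply: le_trans xK; exact: ler_norm.
have := h2 _ nx nK; rewrite !dr ?flow_neq0 ?oppr_eq0//.
by rewrite flowN !opprK addrC distrC.
Qed.

(** Everything in the difference of the derivatives other than the displacement
    along the flow is small uniformly on the whole line. *)
Lemma evol_dx_diff_bound w (M N : R) h x : C10 w -> (forall z, `|w z| <= M) ->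
  (forall z, z != 0 -> `|derive1 w z| <= N) -> x != 0 ->
  `|evol_dx h w x - derive1 w x| <= `|derive1 w (flow h x) - derive1 w x|
    + (N * (expR `|h| - 1) + drift_coef M h + (expR `|h| - 1) * (M * expR `|h|)).
Proof.
move=> wC wM wN x0; have cw := C10_continuous wC.
have M0 : 0 <= M by exact: le_trans (wM 0).
have [_ e1 _ _] := expR_bounds h; have /andP[s1 s2] := slope_bounds h x.
have sl : `|slope h x| <= expR `|h| by rewrite gtr0_norm ?slope_gt0.
have sl1 : `|slope h x - 1| <= expR `|h| - 1.
  rewrite ler_norml lerD2r s2 andbT.
  have ab : expR (- `|h|) * expR `|h| = 1 by rewrite -expRD addNr expR0.
  have := expR_gt0 (- `|h|); have := sqr_ge0 (expR `|h| - 1); nra.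
have /andP[p0 p1] := peakon_bounds x.
have g1 : `|gain h x| <= expR `|h| - 1.
  by apply: le_trans (gain_bound h x) _; rewrite ler_piMl// subr_ge0.
have E : evol_dx h w x - derive1 w x = (derive1 w (flow h x) - derive1 w x)
  + (derive1 w (flow h x) * (slope h x - 1) + - (Num.sg x * drift h w x)
     + gain h x * (w (flow h x) * slope h x)).
  by rewrite evol_dx_drift; ring.
rewrite E; apply: le_trans (ler_normD _ _) _; apply: (lerD (lexx _)).
apply: le_trans (ler_normD _ _) _; apply: lerD; last first.
  by rewrite (normrM (gain h x)) ler_pM// (normrM (w _)) ler_pM.
apply: le_trans (ler_normD _ _) _; apply: lerD.
  by rewrite (normrM (derive1 w _)) ler_pM// wN// flow_neq0.
rewrite normrN (normrM (Num.sg x)) normr_sg x0 mul1r.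
apply: le_trans (drift_bound h x cw wM) _; apply: ler_piMr; last exact: decay_le1.
exact: drift_coef_ge0.
Qed.

Lemma evol_continuous_C10 v : C10 v -> continuous_into_C10 (fun t => evol t v).
Proof.
move=> vC; split => [t|t0]; first exact: C10_evol.
have [M [N [M0 N0 wC wM wN]]] : exists M N, [/\ 0 <= M, 0 <= N, C10 (evol t0 v),
    forall z, `|evol t0 v z| <= M & forall z, z != 0 -> `|derive1 (evol t0 v) z| <= N].
  have wC := C10_evol t0 vC; have [M M0 wM] := C10_bounded wC.
  have [N N0 wN] := C10_derive_bounded wC; by exists M, N.
have evE h := evolDl t0 h vC.
move: wC wM wN evE; set w := evol t0 v; move: w => w wC wM wN evE.
have e0 : expR `|h| @[h --> (0 : R)] --> (1 : R) by apply: cvg_expR_norm; exact: cvg_id.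
have dc : drift_coef M h @[h --> (0 : R)] --> (0 : R) by apply: drift_coef_cvg; exact: cvg_id.
have em : expR `|h| - 1 @[h --> (0 : R)] --> (0 : R).
  by rewrite -[X in _ --> X](subrr 1); apply: cvgB => //; exact: cvg_cst.
split.
- move=> e ep; apply: near_translate.
  have c : N * `|h| + drift_coef M h @[h --> (0 : R)] --> (0 : R).
    have c0 : `|h| @[h --> (0 : R)] --> `|0 : R| by apply: cvg_norm; exact: cvg_id.
    have c1 : N * `|h| + drift_coef M h @[h --> (0 : R)] --> N * `|0 : R| + 0.
      by apply: cvgD => //; exact: cvgMl_tmp.
    by rewrite normr0 mulr0 addr0 in c1.
  move/cvgr0Pnorm_lt : c => /(_ _ ep); apply: filterS => h hc x.
  rewrite evE (_ : evol h w x - w x = (w (flow h x) - w x) + drift h w x); last first.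
    by rewrite /evol /drift; ring.
  apply: le_lt_trans (le_lt_trans (ler_norm _) hc).
  apply: le_trans (ler_normD _ _) _; apply: lerD.
    apply: le_trans (lipschitz_off0 x (flow h x) (C10_continuous wC) _ wN) _.
      by move=> z z0; exact: C10_is_derive wC z0.
    by rewrite ler_wpM2l// flow_near.
  apply: le_trans (drift_bound h x (C10_continuous wC) wM) _.
  by apply: ler_piMr; [exact: drift_coef_ge0|exact: decay_le1].
- move=> K e ep; apply: near_translate.
  have e2 : 0 < e / 2 by rewrite divr_gt0.
  pose r h := N * (expR `|h| - 1) + drift_coef M h + (expR `|h| - 1) * (M * expR `|h|).
  have c : r h @[h --> (0 : R)] --> (0 : R).
    have c1 : N * (expR `|h| - 1) @[h --> (0 : R)] --> N * 0 by exact: cvgMl_tmp.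
    have c2 : M * expR `|h| @[h --> (0 : R)] --> M * 1 by exact: cvgMl_tmp.
    have c3 : r h @[h --> (0 : R)] --> N * 0 + 0 + 0 * (M * 1).
      by apply: cvgD; [exact: cvgD|exact: cvgM].
    by rewrite mulr0 mul0r !addr0 in c3.
  have n1 := derive1_flow_unif K wC e2.
  move/cvgr0Pnorm_lt : c => /(_ _ e2) n2.
  apply: filterS2 n1 n2 => h h1 h2 x x0 xK.
  rewrite evE (derive1_evol h wC x0).
  apply: le_lt_trans (evol_dx_diff_bound h wC wM wN x0) _; rewrite -/(r h) [e]splitr.
  by apply: ltrD; [exact: h1|exact: le_lt_trans (ler_norm _) h2].
- exists (N * 2 + (2 - 1) * M * (2 + 1) + (2 - 1) * (M * 2)).
  apply: near_translate.
  have n1 : \forall h \near (0 : R), `|h| <= 1.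
    have h1 : `|h| @[h --> (0 : R)] --> `|0 : R| by apply: cvg_norm; exact: cvg_id.
    rewrite normr0 in h1.
    exact: (cvgr_le _ h1 _ (@ltr01 R)).
  have n2 : \forall h \near (0 : R), expR `|h| <= 2.
    have l12 : (1 : R) < 2 by rewrite ltr1n.
    exact: (cvgr_le _ e0 _ l12).
  apply: filterS2 n1 n2 => h h1 h2 x x0; rewrite evE (derive1_evol h wC x0).
  apply: le_trans (evol_dx_bound h (C10_continuous wC) wM wN x0) _.
  have [_ f1 _ _] := expR_bounds h; have f2 : 0 <= expR `|h| - 1 by rewrite subr_ge0.
  apply: lerD; first apply: lerD.
  - by rewrite ler_wpM2l.
  - apply: ler_pM; [by rewrite mulr_ge0|by rewrite addr_ge0| |by rewrite lerD2l].
    by rewrite ler_wpM2r// lerD2r.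
  - apply: ler_pM; [by []|by rewrite mulr_ge0// expR_ge0|by rewrite lerD2r|].
    by rewrite ler_wpM2l.
Qed.

End ContinuityC10.

(** * Uniqueness along characteristics *)

Section Uniqueness.
Context {R : realType}.
Implicit Types (D u : R -> R -> R) (s t h x M : R).

(** Uniqueness holds already in this class, which is stable under differences. *)
Definition classical_solution u : Prop :=
  continuous_into_C10 u /\
  forall t x, is_derive t 1 (fun s => u s x) (opA (u t) x).

Lemma opA_B v w x : C10 v -> C10 w -> opA (v \- w) x = opA v x - opA w x.
Proof.
move=> vC wC; rewrite /opA primitiveB; [|exact: C10_continuous..].
have [->|x0] := eqVneq x 0; first by rewrite peakon0 /=; ring.
by rewrite derive1B//=; ring.
Qed.

Lemma classical_solution_B u1 u2 : classical_solution u1 -> classical_solution u2 ->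
  classical_solution (fun t => u1 t \- u2 t).
Proof.
move=> [[C1 c1] d1] [[C2 c2] d2]; split; last first.
  by move=> t x; rewrite (opA_B x (C1 t) (C2 t)); apply: is_deriveB.
split => [t|t0]; first exact: C10_B (C1 t) (C2 t).
have [U1 K1 [M1 B1]] := c1 t0; have [U2 K2 [M2 B2]] := c2 t0.
split.
- move=> e e0; have e2 : 0 < e / 2 by rewrite divr_gt0.
  apply: filterS2 (U1 _ e2) (U2 _ e2) => t h1 h2 x /=.
  rewrite (_ : _ - _ - _ = (u1 t x - u1 t0 x) - (u2 t x - u2 t0 x)); last by ring.
  by apply: le_lt_trans (ler_normB _ _) _; rewrite (splitr e) ltrD.
- move=> K e e0; have e2 : 0 < e / 2 by rewrite divr_gt0.
  apply: filterS2 (K1 K _ e2) (K2 K _ e2) => t h1 h2 x x0 xK.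
  rewrite (derive1B (C1 t) (C2 t) x0) (derive1B (C1 t0) (C2 t0) x0).
  rewrite (_ : _ - _ - _ = (derive1 (u1 t) x - derive1 (u1 t0) x)
     - (derive1 (u2 t) x - derive1 (u2 t0) x)); last by ring.
  apply: le_lt_trans (ler_normB _ _) _; rewrite [e]splitr.
  by apply: ltrD; [exact: h1|exact: h2].
- exists (M1 + M2); apply: filterS2 B1 B2 => t h1 h2 x x0.
  rewrite (derive1B (C1 t) (C2 t) x0).
  apply: le_trans (ler_normB _ _) _.
  by apply: lerD; [exact: h1|exact: h2].
Qed.

(** The profile moves with h together with the points X h and Y h, so that the
    quotient q h is a derivative of D (s + h) at an intermediate point. It
    converges because the derivatives converge locally uniformly in time; the
    sign conditions keep the points on one side of the corner. *)
Lemma space_increment D s (X Y : R -> R) (x : R) : continuous_into_C10 D -> x != 0 ->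
  (forall h, 0 < X h * x) -> (forall h, 0 < Y h * x) ->
  X h @[h --> (0 : R)^'] --> x -> Y h @[h --> (0 : R)^'] --> x ->
  exists2 q : R -> R, q h @[h --> (0 : R)^'] --> derive1 (D s) x &
    forall h, D (s + h) (X h) - D (s + h) (Y h) = q h * (X h - Y h).
Proof.
move=> [DC Dc] x0 Xx Yx Xc Yc.
have mvt h : exists c : R, [/\ c != 0, `|c - x| <= `|X h - x| + `|Y h - x| &
    D (s + h) (X h) - D (s + h) (Y h) = derive1 (D (s + h)) c * (X h - Y h)].
  have nz (a b c : R) : 0 < a * x -> 0 < b * x -> a <= c <= b -> c != 0.
    move=> ax bx /andP[ac cb]; apply/eqP => c0; rewrite c0 in ac cb.
    by have := sqr_ge0 x; nra.
  have seg a b : a <= b -> 0 < a * x -> 0 < b * x -> exists c,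
      [/\ c != 0, a <= c <= b &
       D (s + h) b - D (s + h) a = derive1 (D (s + h)) c * (b - a)].
    move=> ab ax bx.
    have [||c] := @MVT_segment R (D (s + h)) (derive1 (D (s + h))) a b ab.
    - move=> y; rewrite in_itv/= => /andP[ay yb]; apply: C10_is_derive => //.
      by apply: (nz a b) => //; rewrite !ltW.
    - exact: continuous_subspaceT (C10_continuous (DC _)).
    - rewrite in_itv/= => acb E; exists c; split => //; exact: nz acb.
  have near_x a b c : a <= c <= b -> `|c - x| <= `|a - x| + `|b - x|.
    move=> /andP[ac cb]; have := ler_norm (b - x); have := ler_norm (- (a - x)).
    have := normr_ge0 (b - x); have := normr_ge0 (a - x).
    by rewrite normrN ler_norml => *; apply/andP; split; lra.
  have [xy|/ltW yx] := leP (Y h) (X h).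
    have [c [c0 yc E]] := seg _ _ xy (Yx h) (Xx h); exists c; split => //.
    by rewrite [leRHS]addrC; exact: near_x.
  have [c [c0 yc E]] := seg _ _ yx (Xx h) (Yx h); exists c; split => //.
    exact: near_x.
  by rewrite -[LHS]opprB E -mulrN opprB.
pose c h := projT1 (cid (mvt h)).
have cP h : [/\ c h != 0, `|c h - x| <= `|X h - x| + `|Y h - x| &
    D (s + h) (X h) - D (s + h) (Y h) = derive1 (D (s + h)) (c h) * (X h - Y h)].
  by rewrite /c; case: cid.
exists (fun h => derive1 (D (s + h)) (c h)); last by move=> h; have [] := cP h.
have cx : c h @[h --> (0 : R)^'] --> x.
  apply/cvgrPdist_le => e e0; have e2 : 0 < e / 2 by rewrite divr_gt0.
  move/cvgrPdist_le : Xc => /(_ _ e2) n1; move/cvgrPdist_le : Yc => /(_ _ e2) n2.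
  apply: filterS2 n1 n2 => h h1 h2; rewrite distrC.
  have [_ hc _] := cP h; apply: le_trans hc _.
  by rewrite (splitr e) lerD// distrC.
have [_ K1 _] := Dc s; have [_ dv _ _] := DC s.
have cont : derive1 (D s) (c h) @[h --> (0 : R)^'] --> derive1 (D s) x.
  exact: cvg_comp cx (dv _ x0).2.
apply/cvgrPdist_lt => e e0; have e2 : 0 < e / 2 by rewrite divr_gt0.
have n0 : \forall h \near (0 : R)^', forall y, y != 0 -> `|y| <= `|x| + 1 ->
    `|derive1 (D (s + h)) y - derive1 (D s) y| < e / 2.
  have h0 : (s + h) @[h --> (0 : R)^'] --> s.
    have h1 : (s + h) @[h --> (0 : R)^'] --> s + 0.
      by apply: cvgD; [exact: cvg_cst|exact: cvg_dnbhs_id].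
    by rewrite addr0 in h1.
  exact: (h0 _ (K1 (`|x| + 1) _ e2)).
move/cvgrPdist_lt : cont => /(_ _ e2) n1; move/cvgrPdist_le : cx => /(_ _ ltr01) n2.
apply: filterS3 n0 n1 n2 => h h0 h1 h2.
have [c0 _ _] := cP h.
have cb : `|c h| <= `|x| + 1.
  rewrite -[c h](subrK x) addrC (le_trans (ler_normD _ _))// lerD2l.
  by rewrite distrC.
rewrite (_ : _ - _ = (derive1 (D s) x - derive1 (D s) (c h))
  - (derive1 (D (s + h)) (c h) - derive1 (D s) (c h))); last by ring.
apply: le_lt_trans (ler_normB _ _) _; rewrite [e]splitr.
by apply: ltrD; [exact: h1|exact: h0].
Qed.

Lemma is_derive_from_quotient (f : R -> R) (s d : R) :
  h^-1 * (f (s + h) - f s) @[h --> (0 : R)^'] --> d -> is_derive s 1 f d.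
Proof.
move=> fd; have E : (fun h => h^-1 *: (f (h *: 1 + s) - f s)) =
    (fun h => h^-1 * (f (s + h) - f s)).
  by apply/funext => h; rewrite /GRing.scale/= mulr1 (addrC h).
have fd' : h^-1 *: (f (h *: 1 + s) - f s) @[h --> (0 : R)^'] --> d by rewrite E.
apply: DeriveDef; first by apply/cvg_ex; exists d.
exact: cvg_lim fd'.
Qed.

(** Along a characteristic the transport terms cancel and only the nonlocal term
    is left. *)
Lemma is_derive_characteristic D t s x : classical_solution D ->
  is_derive s 1 (fun s => D s (flow (t - s) x))
    (peakon (flow (t - s) x) * primitive (D s) (flow (t - s) x)).
Proof.
move=> [DD dD]; have [DC Dc] := DD.
have [->|x0] := eqVneq x 0.
  have h := dD s 0; rewrite /opA peakon0 subrr mul0r add0r in h.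
  rewrite flow_t0 peakon0; apply: near_eq_is_derive h.
  by apply: filterE => r; rewrite flow_t0.
pose X r := flow (t - r) x; rewrite -/(X s).
have Xs0 : X s != 0 by exact: flow_neq0.
have dX : is_derive s 1 X (- (1 - peakon (X s))).
  have h := is_derive_flow_t (t - s) x.
  have -> : X = (flow ^~ x) \o (fun r => t - r) by [].
  by apply: is_derive_eq; ring.
have X0 r : 0 < X r * X s.
  rewrite -sgr_gt0 sgrM !sgr_flow sgr_sqr//; exact: ltr01.
have Xs : X (s + h) @[h --> (0 : R)^'] --> X s.
  have h1 : (s + h) @[h --> (0 : R)^'] --> s + 0.
    by apply: cvgD; [exact: cvg_cst|exact: cvg_dnbhs_id].
  rewrite addr0 in h1; exact: cvg_comp h1 (is_derive_continuous dX).
have [q qc qE] := @space_increment D s (fun h => X (s + h)) (cst (X s)) (X s) DD Xs0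
  (fun h => X0 (s + h)) (fun _ => X0 s) Xs (cvg_cst _).
apply: is_derive_from_quotient.
have lim : q h * (h^-1 * (X (s + h) - X s)) + h^-1 * (D (s + h) (X s) - D s (X s))
    @[h --> (0 : R)^'] --> derive1 (D s) (X s) * (- (1 - peakon (X s))) + opA (D s) (X s).
  apply: cvgD; first by apply: cvgM => //; exact: quotient_from_is_derive dX.
  exact: quotient_from_is_derive (dD s (X s)).
rewrite (_ : peakon (X s) * _ =
  derive1 (D s) (X s) * (- (1 - peakon (X s))) + opA (D s) (X s)); last first.
  by rewrite /opA; ring.
apply: cvg_eqfun lim => h; rewrite -/(X (s + h)).
rewrite (_ : D (s + h) (X (s + h)) - D s (X s) =
  (D (s + h) (X (s + h)) - D (s + h) (X s)) + (D (s + h) (X s) - D s (X s))); last by ring.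
by have /= qh := qE h; rewrite qh; ring.
Qed.

Lemma mean_value_le (f df : R -> R) (a b B : R) :
  (forall r : R, is_derive r 1 f (df r)) ->
  (forall r : R, `|r - a| <= `|b - a| -> `|df r| <= B) -> `|f b - f a| <= B * `|b - a|.
Proof.
move=> dfr dfB.
have cf : continuous f by move=> r; exact: is_derive_continuous (dfr r).
have [ab|/ltW ba] := leP a b.
  have [c] := @MVT_segment R f df a b ab (fun r _ => dfr r) (continuous_within_itv cf).
  rewrite in_itv/= => /andP[ac cb] ->; rewrite (normrM (df c)) ler_wpM2r//.
  by apply: dfB; rewrite !ger0_norm ?subr_ge0// lerD2r.
have [c] := @MVT_segment R f df b a ba (fun r _ => dfr r) (continuous_within_itv cf).
rewrite in_itv/= => /andP[bc ca] E; rewrite distrC E (normrM (df c)) (distrC a b) ler_wpM2r//.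
by apply: dfB; rewrite !ler0_norm ?subr_le0// lerN2 lerD2r.
Qed.

(** A bound on a short time interval is improved by a factor one half, because the
    nonlocal term is controlled by the sup norm. *)
Lemma classical_solution_near0 D t0 : classical_solution D ->
  (forall x, D t0 x = 0) -> \forall t \near t0, forall x, D t x = 0.
Proof.
move=> DS D0; have [[DC Dc] _] := DS; have [U _ _] := Dc t0.
have /nbhs_ballP[d /= d0 hd] := U 1 ltr01.
(* On this interval the sup norm of D is at most 1 to begin with; the nonlocal
   term is at most twice the sup norm, and 2 / 4 = 1 / 2. *)
pose r := Num.min (d / 2) (4^-1).
have r0 : 0 < r by rewrite lt_min divr_gt0//= invr_gt0 ltr0n.
have r4 : r <= 4^-1 by rewrite /r ge_min lexx orbT.
have rd : r < d.
  apply: (@le_lt_trans _ _ (d / 2)); first by rewrite /r ge_min lexx.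
  by rewrite ltr_pdivrMr// ltr_pMr// ltr1n.
have bnd n : forall t, `|t - t0| <= r -> forall x, `|D t x| <= 2^-1 ^+ n.
  elim: n => [|n IH] t tr x.
    rewrite expr0 ltW//; have := hd t _ x; rewrite D0 subr0; apply.
    by rewrite /ball/= distrC (le_lt_trans tr).
  have cv s := C10_continuous (DC s).
  have := @mean_value_le (fun s => D s (flow (t - s) x)) _ t0 t (2 * 2^-1 ^+ n)
    (fun s => is_derive_characteristic t s x DS).
  rewrite subrr flow_0x D0 subr0 => h.
  have {}h : `|D t x| <= 2 * 2^-1 ^+ n * `|t - t0|.
    apply: h => s st; have IHs := IH s (le_trans st tr).
    have p0 := expR_ge0 (- `|flow (t - s) x|); rewrite -/(peakon _) in p0.
    rewrite (normrM (peakon _)) (ger0_norm p0).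
    apply: (@le_trans _ _ (peakon (flow (t - s) x) * (2^-1 ^+ n * `|flow (t - s) x|))).
      by rewrite ler_wpM2l//; apply: primitive_bound => // z; exact: IHs.
    rewrite mulrCA mulrC ler_wpM2r ?exprn_ge0 ?invr_ge0//.
    apply: le_trans (peakon_growth _) _.
    by rewrite ler_piMr// -/(decay _) decay_le1.
  apply: le_trans h _; rewrite exprS mulrAC ler_wpM2r ?exprn_ge0 ?invr_ge0//.
  have := le_trans tr r4; lra.
have : \forall t \near t0, `|t - t0| <= r.
  apply/nbhs_ballP; exists r => //= t; rewrite /ball/= distrC => h; exact: ltW.
apply: filterS => t tr x; apply/eqP; rewrite -normr_le0.
have lim : (2^-1 : R) ^+ n @[n --> \oo] --> (0 : R).
  by apply: cvg_expr; rewrite ger0_norm ?invr_ge0// invf_lt1// ltr1n.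
apply: (cvgr_to_ge lim).
by apply: nearW => n; exact: bnd.
Qed.

(** The set of times at which D vanishes is open by the preceding lemma, and closed
    by continuity in time. *)
Lemma classical_solution_eq0 D : classical_solution D ->
  (forall x, D 0 x = 0) -> forall t x, D t x = 0.
Proof.
move=> DS D0; pose Z : set R := [set t | forall x, D t x = 0].
suff : Z = setT by move=> ZT t; have : Z t by rewrite ZT.
have oZ : open Z.
  by rewrite openE => t Zt; exact: classical_solution_near0.
have cZ : closed Z.
  rewrite -openC openE => t /= /existsNP[x /eqP Dx].
  have [_ dD] := DS; have c := is_derive_continuous (dD t x).
  have p : 0 < `|D t x| by rewrite normr_gt0.
  have n : \forall s \near t, 0 < `|D s x| by exact: (cvgr_norm_gt _ c _ p).
  by apply: filterS n => s /=; rewrite normr_gt0 => /eqP ds Zs; apply: ds; exact: Zs.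
have cT : connected [set: R].
  by apply/connected_intervalP => a b _ _ c _.
apply: cT.
- by exists 0.
- by exists Z => //; rewrite setTI.
- by exists Z => //; rewrite setTI.
Qed.

Lemma classical_solution_unique u1 u2 : classical_solution u1 -> classical_solution u2 ->
  u1 0 = u2 0 -> u1 = u2.
Proof.
move=> S1 S2 E; apply/funext => t; apply/funext => x; apply/subr0_eq.
apply: (classical_solution_eq0 (classical_solution_B S1 S2)).
by move=> y; rewrite /= E subrr.
Qed.

End Uniqueness.

Unset Implicit Arguments.

(** * Existence and uniqueness *)

Theorem lemma3 (R : realType) (v0 : R -> R)
    (v0_H1 : H1 v0) (v0_C10 : C10 v0) (v0_0 : v0 0 = 0) :
  exists v : R -> R -> R,
    [/\ solution v0 v,
        forall t : R, v t 0 = 0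
      & forall w : R -> R -> R, solution v0 w -> w = v].
Proof.
have cC := evol_continuous_C10 v0_C10.
have sE := evol_solves v0_C10 v0_H1.
exists (fun t => evol t v0); split.
- split => //; first exact: evol_continuous_H1.
  exact: evol0.
- by move=> t; rewrite evol_t0.
- move=> w [_ wC wE w0]; apply: classical_solution_unique.
  + by split => // t x; exact: (wE t).2.
  + by split => // t x; exact: (sE t).2.
  + by rewrite w0 evol0.
Qed.
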